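(* Let $k$ be an algebraically closed field of characteristic $p>0$, let $\ell$ be an odd prime such that $p$ is a generator of the group $(\mathbb Z/\ell\mathbb Z)^\times$, and let $X$ be the hyperelliptic curve over $k$ with affine model $y^2+y=x^\ell$, embedded in its jacobian $J$ using the point at infinity $\infty$ as base point. Then there are infinitely many integers $N$ for which $\sharp (X\cap J[N])\geq N^2$.
   Context: $X$ is the smooth projective completion of the affine curve by one point $\infty$, viewed as a subset of $J$ via $\xi\mapsto$ class of $[\xi]-[\infty]$ (it has genus $(\ell-1)/2$; for $\ell=3$ it is an elliptic curve). $J[N]$ is the subgroup of $J(k)$ of points of order dividing the positive integer $N$. *)

(* Defs.v *)
From HB Require Import structures.
From mathcomp Require Import all_boot all_order all_algebra all_fingroup.
From mathcomp Require Import all_solvable qfpoly.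
From mathcomp Require Import classical_sets boolp functions cardinality.
From mathcomp Require Import freeg zify ring.

Set Implicit Arguments.
Unset Strict Implicit.
Unset Printing Implicit Defensive.

Import Order.TTheory GRing.Theory Num.Theory.
Local Open Scope quotient_scope.
Local Open Scope classical_set_scope.
Local Open Scope ring_scope.

Local Notation "x %:F" := (@FracField.tofrac _ x).

Lemma fraction_quot (R : idomainType) (z : {fraction R}) :
  exists n d : R, d != 0 /\ z * d%:F = n%:F.
Proof.
exists \n_(generic_quotient.repr z), \d_(generic_quotient.repr z).
split; first exact: denom_ratioP.
rewrite -{1}[z]reprK; unlock FracField.tofrac.
rewrite -[LHS]FracField.pi_mul; apply/eqmodP => /=.
by rewrite FracField.equivfE /FracField.mulf !numden_Ratio
           ?mulf_neq0 ?oner_eq0 ?denom_ratioP // !mulr1 mulrC.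
Qed.

Definition curve_poly (k : fieldType) (l : nat) : {poly {fraction {poly k}}} :=
  'X^2 + 'X - (('X^l : {poly k})%:F)%:P.

Lemma curve_poly_irr (k : fieldType) (l : nat) :
  odd l -> monic_irreducible_poly (curve_poly k l).
Proof.
move=> l_odd.
have E : curve_poly k l = 'X^2 + ('X - (('X^l : {poly k})%:F)%:P).
  by rewrite /curve_poly addrA.
have s2 : (size ('X - (('X^l : {poly k})%:F)%:P)%R
           < size ('X^2 : {poly {fraction {poly k}}})%R)%N.
  by rewrite size_XsubC size_polyXn.
have sz : size (curve_poly k l) = 3%N by rewrite E size_polyDl // size_polyXn.
split; last by rewrite E monicE lead_coefDl // -monicE monicXn.
apply: cubic_irreducible; first by rewrite sz.
move=> z; apply/negP => /rootP.
have [a [b [b0 zb]]] := fraction_quot z.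
rewrite /curve_poly !hornerE => ez.
have : a * (a + b) = 'X^l * (b * b).
  apply/eqP; rewrite -tofrac_eq; apply/eqP.
  rewrite !(tofracM, tofracD) -zb.
  move/eqP: ez; rewrite subr_eq0 => /eqP <-; ring.
move/(congr1 (fun p : {poly k} => size p)).
have sbb : size (b * b) = (size b + size b).-1 by rewrite size_mul.
have sb : (0 < size b)%N by rewrite size_poly_gt0.
rewrite (@size_monicM _ 'X^l) ?monicXn ?mulf_neq0 // size_polyXn sbb.
have [lt_ba|le_ab] := ltnP (size b) (size a).
  have sab : size (a + b) = size a by rewrite size_polyDl.
  have a0 : a != 0 by rewrite -size_poly_gt0; lia.
  have ab0 : a + b != 0 by rewrite -size_poly_gt0 sab; lia.
  rewrite size_mul // sab; lia.
have := size_polyMleq a (a + b); have := size_polyD a b.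
rewrite (maxn_idPr le_ab) => sD sM sE.
by move: (size _) (size _) (size _) (size _) sb sD sM sE le_ab => *; lia.
Qed.

Section Curve.
Variables (k : fieldType) (l : nat) (l_odd : odd l).

(* k(X) = k(x)[y] / (y^2 + y - x^l) *)
Definition function_field : Type :=
  {poly %/ curve_poly k l with curve_poly_irr k l_odd}.
HB.instance Definition _ := GRing.Field.on function_field.

Local Notation K := function_field.

Definition fconst : k -> K :=
  qpolyC (curve_poly k l) \o @FracField.tofrac {poly k} \o polyC.
HB.instance Definition _ := GRing.RMorphism.on fconst.

Definition fx : K := qpolyC (curve_poly k l) ('X%:F).
Definition fy : K := qpolyX (curve_poly k l).

Lemma fxyP : fy ^+ 2 + fy = fx ^+ l.
Proof.
have hI := curve_poly_irr k l_odd.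
pose phi := in_qpoly (curve_poly k l).
have phiC c : phi c%:P = qpolyC (curve_poly k l) c.
  apply: val_inj; rewrite /= Pdiv.CommonRing.rmodp_small //.
  rewrite (leq_ltn_trans (size_polyC_leq1 _)) //.
  exact: size_mk_monic_gt1.
have h0 : phi (curve_poly k l) = 0.
  apply: val_inj; rewrite /= mk_monicE //.
  apply: Pdiv.RingMonic.rmodpp; exact: hI.2.
have : phi ('X^2 + 'X) = phi (('X^l : {poly k})%:F)%:P.
  by apply/eqP; rewrite -subr_eq0 /phi -rmorphB; apply/eqP.
rewrite phiC /phi rmorphD rmorphXn tofracXn rmorphXn; exact.
Qed.

(* The k-points of X, None being the point at infinity. *)
Definition point : Type := option {P : k * k | P.2 ^+ 2 + P.2 == P.1 ^+ l}.
HB.instance Definition _ := Choice.on point.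

(* Polynomials in two variables are elements G of {poly {poly k}}, the outer
   variable being the first one: G.[a, b] is the value at (a, b).
   local_ring s t a b is the local ring at the point (a, b) of an affine model
   of X with coordinate functions s and t. *)
Definition bieval (G : {poly {poly k}}) (s t : K) : K :=
  (map_poly (map_poly fconst) G).[s, t].

Definition local_ring (s t : K) (a b : k) : set K :=
  [set f | exists G H : {poly {poly k}},
     H.[a, b] != 0 /\ f = bieval G s t / bieval H s t].

(* With u = 1/x, w = y/x^m and m = (l+1)/2, the affine model
   w^2 + u^m w = u is smooth over u = 0, where it has the single point
   (0, 0); glued with the model y^2 + y = x^l it gives X. *)
Definition regular_at (P : point) : set K :=
  match P with
  | Some Q => local_ring fx fy (val Q).1 (val Q).2
  | None => local_ring fx^-1 (fy / fx ^+ l.+1./2) 0 0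
  end.

Definition unit_at (P : point) : set K :=
  [set f | [/\ f != 0, regular_at P f & regular_at P f^-1]].

Definition maximal_at (P : point) : set K := regular_at P `\` unit_at P.

Definition uniformizer (P : point) (t : K) : Prop :=
  maximal_at P t /\
  forall f, maximal_at P f -> exists2 g, regular_at P g & f = g * t.

(* When l is nonzero in k the curve X is smooth, so that all its local rings are
   discrete valuation rings: uniformizers exist and differ by units, and
   quantifying over all of them amounts to choosing one. *)
Definition has_order (P : point) (f : K) (n : int) : Prop :=
  forall t, uniformizer P t -> unit_at P (f / t ^ n).

Lemma regular_atM P f g :
  regular_at P f -> regular_at P g -> regular_at P (f * g).
Proof.
have local_ringM s t a b : local_ring s t a b f -> local_ring s t a b g ->
    local_ring s t a b (f * g).
  move=> [G [H [H0 ->]]] [G' [H' [H'0 ->]]]; exists (G * G'), (H * H'); split.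
    by rewrite !hornerM mulf_neq0.
  by rewrite /bieval !rmorphM !hornerM invfM mulrACA.
by case: P => [Q|] /=; apply: local_ringM.
Qed.

Lemma regular_at1 P : regular_at P 1.
Proof.
have local_ring1 s t a b : local_ring s t a b 1.
  exists 1, 1; split; first by rewrite !hornerC oner_neq0.
  by rewrite /bieval !rmorph1 !hornerC divr1.
by case: P => [Q|]; apply: local_ring1.
Qed.

Lemma unit_atM P f g : unit_at P f -> unit_at P g -> unit_at P (f * g).
Proof.
move=> [f0 fr fVr] [g0 gr gVr]; split; rewrite ?mulf_neq0 //.
  exact: regular_atM.
by rewrite invfM; apply: regular_atM.
Qed.

Lemma unit_at1 P : unit_at P 1.
Proof. by split; rewrite ?invr1 ?oner_neq0 //; apply: regular_at1. Qed.

Lemma unit_atV P f : unit_at P f -> unit_at P f^-1.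
Proof. by move=> [f0 fr fVr]; split; rewrite ?invr_eq0 ?invrK. Qed.

Lemma has_order1 P : has_order P 1 0.
Proof. by move=> t _; rewrite expr0z divr1; apply: unit_at1. Qed.

Lemma has_orderMV P f g m n :
  has_order P f m -> has_order P g n -> has_order P (f / g) (m - n).
Proof.
move=> hf hg t ut.
have {hf} [fm0 fmr fmVr] := hf t ut; have {}hg := hg t ut.
have -> : f / g / t ^ (m - n) = f / t ^ m * (g / t ^ n)^-1.
  have [gn0 _ _] := hg.
  have [t0|t0] := eqVneq t 0; last first.
    by rewrite expfzDr // -invr_expz !invfM !invrK mulrACA.
  have z0 i h : h / t ^ i != 0 -> i = 0.
    by apply: contraNeq => i0; rewrite t0 exp0rz (negPf i0) invr0 mulr0.
  by rewrite (z0 _ _ fm0) (z0 _ _ gn0) subrr expr0z !divr1.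
by apply: unit_atM => //; apply: unit_atV.
Qed.

Definition degree0 : {pred {freeg point}} := [pred D | deg D == 0].
Fact degree0_zmod_closed : zmod_closed degree0.
Proof.
split=> [|D E]; rewrite !inE ?raddf0 // => /eqP D0 /eqP E0.
by rewrite raddfB /= D0 E0.
Qed.
HB.instance Definition _ :=
  GRing.isZmodClosed.Build {freeg point} degree0 degree0_zmod_closed.

Record divisor0 : Type := Divisor0 {
  div0_val :> {freeg point};
  div0_deg : div0_val \in degree0 }.
HB.instance Definition _ := [isSub for div0_val].
HB.instance Definition _ := [Choice of divisor0 by <:].
HB.instance Definition _ := [SubChoice_isSubZmodule of divisor0 by <:].

Definition principal : {pred divisor0} :=
  [pred D : divisor0 |
    `[< exists2 f : K, f != 0 & forall P, has_order P f (coeff P D) >]].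
Fact principal_zmod_closed : zmod_closed principal.
Proof.
split=> [|D E].
  apply/asboolP; exists 1; rewrite ?oner_neq0 // => P.
  by rewrite coeff0; apply: has_order1.
move=> /asboolP[f f0 fD] /asboolP[g g0 gE]; apply/asboolP.
exists (f / g); first by rewrite mulf_neq0 ?invr_eq0.
by move=> P; rewrite /= coeffB; apply: has_orderMV.
Qed.
HB.instance Definition _ :=
  GRing.isZmodClosed.Build divisor0 principal principal_zmod_closed.

(* J(k), as the group of divisor classes of degree zero. *)
Definition jacobian : Type := Quotient.quot principal.
HB.instance Definition _ := GRing.Zmodule.on jacobian.

Fact embed_degree0 (P : point) : <<P>> - <<None>> \in degree0.
Proof. by rewrite inE raddfB /= !degU subrr. Qed.

Definition embed (P : point) : jacobian :=
  \pi_(Quotient.quot principal) (Divisor0 (embed_degree0 P)).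

Definition torsion (N : nat) : set jacobian := [set j | j *+ N = 0].

End Curve.

(* Main.v *)
Require Import Defs.
From mathcomp Require Import all_boot all_order all_algebra all_fingroup.
From mathcomp Require Import all_solvable qfpoly separable cyclotomic.
From mathcomp Require Import classical_sets cardinality boolp.
From mathcomp Require Import freeg zify ring.

(** Let Q be a power of p with Q = -1 modulo l, put n = Q + 1 = l m, and let F
    be the subfield of k with Q^2 elements. The curve X is maximal over F: the
    Q^2-power Frobenius acts on J as multiplication by - Q. Hence every F-point
    of X is killed by n, and X has Q^2 + 1 + (l - 1) Q points over F, which is at
    least n^2 because l >= 3. Since p generates the units modulo l, some power
    p^j is -1 modulo l, and the odd powers of p^j are infinitely many such Q.
    Both facts about the F-points are proved here by explicit formulas.

    Torsion. A tangent line of the curve s^n + t^n = 1 meets it with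
    multiplicity Q at its point of contact and once more at the Frobenius image
    of that point. With - y = s^n, and v equal to s t up to a constant, this
    curve covers y^2 + y = v^n, which covers X through x = v^m. Up to constants,
    the norm of the equation of the tangent to the middle curve is
      E(v0^Q v) - b^Q - (2 b^Q + 1) y, where E(z^2 + z) = z^Q + z + 2 z^Q z,
    and frobenius_line_norm multiplies it by its conjugate under
    y -> - 1 - y. Multiplying the substitutions v -> e v over the m-th roots of
    unity e gives a function A(x) + B(x) y on X. When (a, b) is an F-point with
    2 b + 1 <> 0, its norm to k(x) is a constant times (x - a)^n and it does not
    vanish at the conjugate of (a, b) (osculating_function), so that its divisor
    is n times [(a, b)] - [oo] (order_at_single). When 2 b + 1 = 0, the function
    (x - a)^(n / 2) has this divisor (order_at_branch).

    Number of points. An element y of F outside the subfield with Q elements is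
    determined by z = y^(Q - 1) and t / z = (y + 1)^(Q - 1), two distinct n-th
    roots of unity other than 1, and every such pair occurs, for
    y = (t - z) / (z^2 - t). Moreover y^2 + y is an l-th power in F if and only
    if t^m = 1, and then it has l roots there. Counting the pairs (z, t), and
    adding the y in the subfield, gives the number above (many_points).

    Injectivity of X -> J. If f has divisor P - P' with P' = (a', b') affine,
    then f (x - a') is regular on the affine curve, hence of the form
    A(x) + B(x) y (regular_everywhere), with a pole of order at most 2 at
    infinity. As y has a pole of order l >= 3 there, B = 0 and A has degree one;
    since A vanishes at a', f is constant (no_simple_pole).

    Orders are computed through the relation value_at P f c, which says that f
    is regular at P with value c. It is compatible with the ring operations and
    with inverses of nonzero values, and both affine charts of X are handled at
    once as plane models t^2 + al(s) t = be(s). *)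

Set Implicit Arguments.
Unset Strict Implicit.
Unset Printing Implicit Defensive.

Import GRing.Theory.
Local Open Scope quotient_scope.
Local Open Scope classical_set_scope.
Local Open Scope ring_scope.

(** * The function field as pairs of rational functions *)

Lemma coef_line0 (F : nzRingType) (a b : F) :
  a%:P + b%:P * 'X = 0 -> a = 0 /\ b = 0.
Proof.
move=> E; have Ei i : (a%:P + b%:P * 'X)`_i = 0 by rewrite E coef0.
by have := Ei 0%N; have := Ei 1%N; rewrite !coefD !coefMX !coefC ?addr0 ?add0r.
Qed.

Lemma poly_line (F : nzRingType) (f : {poly F}) :
  (size f <= 2)%N -> f = (f`_0)%:P + (f`_1)%:P * 'X.
Proof.
move=> sf; apply/polyP => -[|[|i]]; rewrite coefD coefMX !coefC ?addr0 ?add0r //.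
by rewrite nth_default // (leq_trans sf).
Qed.

Lemma line_common_denominator (F : comNzRingType) (a b c d z : F) :
  (a + b * z) * (c * d) = a * c * d + b * d * c * z.
Proof. by ring. Qed.

Section FunctionField.
Variables (k : fieldType) (l : nat) (l_odd : odd l).
Local Notation K := (function_field k l_odd).
Local Notation fc := (@fconst k l l_odd).
Local Notation x := (fx k l_odd).
Local Notation y := (fy k l_odd).
Local Notation ev A := (map_poly fc A).[x].

Lemma evE (A : {poly k}) :
  ev A = qpolyC (curve_poly k l) (FracField.tofrac A) :> K.
Proof.
pose g : {poly k} -> K := qpolyC (curve_poly k l) \o @FracField.tofrac {poly k}.
elim/poly_ind: A => [|A c IH]; first by rewrite rmorph0 horner0 !rmorph0.
rewrite rmorphD rmorphM /= map_polyX map_polyC /= !hornerE IH.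
by rewrite !rmorphD !rmorphM.
Qed.

Lemma size_curve_poly : size (curve_poly k l) = 3%N.
Proof.
rewrite /curve_poly -addrA size_polyDl ?size_polyXn //.
by rewrite -[leqLHS]/(size ('X - _ :{poly _})%R).+1 size_XsubC.
Qed.

Lemma qpoly_line (c d : {fraction {poly k}}) :
  qpolyC (curve_poly k l) c + qpolyC (curve_poly k l) d * y
    = c%:P + d%:P * 'X :> {poly {fraction {poly k}}}.
Proof.
have hI := curve_poly_irr k l_odd.
have Xm : mk_monic (curve_poly k l) = curve_poly k l by rewrite mk_monicE.
rewrite poly_of_qpolyD qpolyCE poly_of_qpolyM qpolyCE qpolyXE ?size_curve_poly //; last exact: hI.2.
rewrite Pdiv.CommonRing.rmodp_small // Xm size_curve_poly mul_polyC.
by rewrite (leq_ltn_trans (size_scale_leq _ _)) // size_polyX.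
Qed.

Lemma curve_free (A B : {poly k}) : ev A + ev B * y = 0 -> A = 0 /\ B = 0.
Proof.
rewrite !evE => /(congr1 (fun f : {poly %/ curve_poly k l} => f : {poly {fraction {poly k}}})).
rewrite qpoly_line => /coef_line0[A0 B0].
split; apply/eqP; first by rewrite -(tofrac_eq0 A) A0 eqxx.
by rewrite -(tofrac_eq0 B) B0 eqxx.
Qed.

(** x is transcendental over k. *)
Lemma eval_fx_eq0 (A : {poly k}) : (ev A == 0) = (A == 0).
Proof.
apply/eqP/eqP => [A0|->]; last by rewrite rmorph0 horner0.
by have [] := @curve_free A 0; rewrite // A0 rmorph0 horner0 mul0r addr0.
Qed.

Lemma function_fieldP (f : K) :
  exists A B D : {poly k}, D != 0 /\ f = (ev A + ev B * y) / ev D.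
Proof.
have sf : (size (f : {poly {fraction {poly k}}}) <= 2)%N.
  have s3 : (size (mk_monic (curve_poly k l)) <= 3)%N.
    by rewrite (mk_monicE (curve_poly_irr k l_odd)) size_curve_poly.
  exact: leq_trans (size_mk_monic f) s3.
have Ef : f = qpolyC (curve_poly k l) f`_0 + qpolyC (curve_poly k l) f`_1 * y.
  by apply: val_inj; rewrite [RHS]qpoly_line [LHS]poly_line.
have [a [b [b0 Eab]]] := fraction_quot f`_0.
have [c [d [d0 Ecd]]] := fraction_quot f`_1.
exists (a * d), (c * b), (b * d); split; first by rewrite mulf_neq0.
have bd0 : ev (b * d) != 0 by rewrite eval_fx_eq0 mulf_neq0.
apply/(mulIf bd0); rewrite divfK // {1}Ef !evE !tofracM.
rewrite -Eab -Ecd !qpolyCM; exact: line_common_denominator.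
Qed.
End FunctionField.

(** * Local rings of a plane model *)

(** Polynomials are reduced with t^2 = be(s) - al(s) t. The coefficients A and B
    do not depend on the ring: the same pair serves for the functions s, t and
    for the coordinates of a point. *)
Lemma bivariate_reduction (k : comNzRingType) (al be : {poly k})
    (G : {poly {poly k}}) :
  exists A B : {poly k}, forall (R : comNzRingType) (phi : {rmorphism k -> R})
    (s t : R), t ^+ 2 + (map_poly phi al).[s] * t = (map_poly phi be).[s] ->
  (map_poly (map_poly phi) G).[s, t]
    = (map_poly phi A).[s] + (map_poly phi B).[s] * t.
Proof.
have inner (c : {poly k}) : exists A B : {poly k},
    forall (R : comNzRingType) (phi : {rmorphism k -> R}) (s t : R),
    t ^+ 2 + (map_poly phi al).[s] * t = (map_poly phi be).[s] ->
    (map_poly phi c).[t] = (map_poly phi A).[s] + (map_poly phi B).[s] * t.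
  elim/poly_ind: c => [|c c0 [A [B IH]]].
    by exists 0, 0 => R phi s t _; rewrite !rmorph0 !horner0 mul0r addr0.
  exists (B * be + c0%:P), (A - B * al) => R phi s t E.
  rewrite !(rmorphD, rmorphM, rmorphN) /= map_polyX map_polyC !hornerE.
  rewrite (IH R phi s t E) -E; ring.
elim/poly_ind: G => [|G c [A [B IH]]].
  by exists 0, 0 => R phi s t _; rewrite !rmorph0 !horner0 mul0r addr0.
have [A' [B' IH']] := inner c.
exists (A * 'X + A'), (B * 'X + B') => R phi s t E.
rewrite !(rmorphD, rmorphM) /= !map_polyX map_polyC !hornerE.
rewrite (IH R phi s t E) (IH' R phi s t E); ring.
Qed.

Section PlaneModel.
Variables (k K : fieldType) (phi : {rmorphism k -> K}) (s t : K).
Variables (al be : {poly k}).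
Local Notation ev A := (map_poly phi A).[s].
Hypothesis model : t ^+ 2 + ev al * t = ev be.
Hypothesis free : forall A B : {poly k}, ev A + ev B * t = 0 -> A = 0 /\ B = 0.
Variables (a b : k).
Hypothesis on_model : b ^+ 2 + al.[a] * b = be.[a].
Local Notation bi G := (map_poly (map_poly phi) G).[s, t].

(** Regularity at (a, b) and the value there, as a relation since functions are
    only partially defined at the point. *)
Definition value (f : K) (c : k) : Prop :=
  exists G H : {poly {poly k}},
    [/\ H.[a, b] != 0, f = bi G / bi H & c = G.[a, b] / H.[a, b]].

Lemma bivariate_reduction_at (G : {poly {poly k}}) :
  exists A B : {poly k}, bi G = ev A + ev B * t
    /\ G.[a, b] = A.[a] + B.[a] * b.
Proof.
have [A [B AB]] := bivariate_reduction al be G.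
exists A, B; split; first exact: AB.
have idP (p : {poly k}) : map_poly idfun p = p by apply: map_poly_id.
have := AB k idfun a b; rewrite !idP => <- //.
by congr (_.[_, _]); apply/esym/map_poly_id => p _ /=; rewrite idP.
Qed.

(** A polynomial representing the function 0 has A = B = 0, hence vanishes at
    every point: evaluation at (a, b) is well defined on functions. *)
Lemma bi_neq0 G : G.[a, b] != 0 -> bi G != 0.
Proof.
apply: contra_neq; have [A [B [-> ->]]] := bivariate_reduction_at G.
by move=> /free[-> ->]; rewrite !horner0 mul0r addr0.
Qed.

Lemma value_unique f c c' : value f c -> value f c' -> c = c'.
Proof.
move=> [G [H [H0 -> ->]]] [G' [H' [H'0 E ->]]].
have /eqP := E; rewrite eqr_div ?bi_neq0 // -subr_eq0 => E0.
apply/eqP; rewrite eqr_div // -subr_eq0.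
apply: contraTT E0 => E0.
have := @bi_neq0 (G * H' - G' * H).
by rewrite !rmorphB !rmorphM /= !(hornerD, hornerN, hornerM); apply.
Qed.

Lemma valueC c : value (phi c) c.
Proof.
exists c%:P%:P, 1; rewrite ?rmorph1 !map_polyC /= map_polyC /= !hornerC.
by rewrite oner_neq0 !divr1.
Qed.

Lemma value1 : value 1 1.
Proof. by have := valueC 1; rewrite rmorph1. Qed.

Lemma value0 : value 0 0.
Proof. by have := valueC 0; rewrite rmorph0. Qed.

Lemma value_s : value s a.
Proof.
exists 'X, 1; rewrite ?rmorph1 !map_polyX !hornerC !hornerX !hornerC.
by rewrite oner_neq0 !divr1.
Qed.

Lemma value_t : value t b.
Proof.
exists 'X%:P, 1; rewrite ?rmorph1 !map_polyC /= map_polyX !hornerC !hornerX.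
by rewrite oner_neq0 !divr1.
Qed.

Lemma valueM f g c d : value f c -> value g d -> value (f * g) (c * d).
Proof.
move=> [G [H [H0 -> ->]]] [G' [H' [H'0 -> ->]]].
exists (G * G'), (H * H'); split; first by rewrite !hornerM mulf_neq0.
  by rewrite !rmorphM !hornerM invfM mulrACA.
by rewrite !hornerM invfM mulrACA.
Qed.

Lemma valueD f g c d : value f c -> value g d -> value (f + g) (c + d).
Proof.
move=> [G [H [H0 -> ->]]] [G' [H' [H'0 -> ->]]].
exists (G * H' + G' * H), (H * H'); split; first by rewrite !hornerM mulf_neq0.
  by rewrite !(rmorphM, rmorphD) /= !(hornerM, hornerD) addf_div ?bi_neq0.
by rewrite !(hornerM, hornerD) addf_div.
Qed.

Lemma valueN f c : value f c -> value (- f) (- c).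
Proof.
move=> vf; have := valueM (valueC (- 1)) vf.
by rewrite rmorphN rmorph1 !mulN1r.
Qed.

Lemma valueB f g c d : value f c -> value g d -> value (f - g) (c - d).
Proof. by move=> vf vg; apply: valueD => //; apply: valueN. Qed.

Lemma valueX f c n : value f c -> value (f ^+ n) (c ^+ n).
Proof.
move=> vf; elim: n => [|n IH]; first exact: value1.
by rewrite !exprS; apply: valueM.
Qed.

Lemma valueV f c : c != 0 -> value f c -> value f^-1 c^-1.
Proof.
move=> c0 [G [H [H0 -> cE]]]; exists H, G; rewrite !invf_div cE invf_div.
by split=> //; apply: contraNneq c0 => G0; rewrite cE G0 mul0r.
Qed.

Lemma value_poly (A : {poly k}) : value (ev A) A.[a].
Proof.
elim/poly_ind: A => [|A c IH]; first by rewrite rmorph0 !horner0; apply: value0.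
rewrite rmorphD rmorphM /= map_polyX map_polyC !hornerE.
by apply: valueD (valueC c); apply: valueM IH value_s.
Qed.

Lemma value_neq0 f c : c != 0 -> value f c -> f != 0.
Proof.
by move=> c0 vf; apply: contra_neq c0 => f0; apply: value_unique vf _; rewrite f0; apply: value0.
Qed.

(** Write the numerator as A(s) + B(s) t with A(a) + B(a) b = 0, and divide
    A - A(a) and B - B(a) by s - a; the remaining term is B(a) (t - b). *)
Lemma value0_decomp f : value f 0 -> exists g h,
  [/\ exists c, value g c, exists c, value h c &
      f = g * (s - phi a) + h * (t - phi b)].
Proof.
move=> [G [H [H0 -> /esym/eqP]]].
rewrite mulf_eq0 invr_eq0 (negPf H0) orbF => /eqP.
have [A [B [-> ->]]] := bivariate_reduction_at G => AB0.
have vH : value (bi H) H.[a, b].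
  exists H, 1; rewrite rmorph1 !hornerC oner_neq0 !divr1; split=> //.
have vHV := valueV H0 vH.
have split_at (C : {poly k}) :
    exists2 C1 : {poly k}, True & ev C = phi C.[a] + ev C1 * (s - phi a).
  have /factor_theorem[C1 C1E] : root (C - C.[a]%:P) a.
    by rewrite /root !hornerE subrr.
  exists C1 => //; have -> : C = C.[a]%:P + C1 * ('X - a%:P) by rewrite -C1E addrC subrK.
  by rewrite rmorphD rmorphM /= map_polyXsubC map_polyC !hornerE subrr mulr0 addr0.
have [A1 _ ->] := split_at A; have [B1 _ ->] := split_at B.
exists ((ev A1 + ev B1 * t) / bi H), (phi B.[a] / bi H); split.
- exists ((A1.[a] + B1.[a] * b) / H.[a, b]); apply: valueM vHV.
  by apply: valueD (value_poly _) _; apply: valueM (value_poly _) value_t.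
- by exists (B.[a] / H.[a, b]); apply: valueM vHV; apply: valueC.
have -> : phi A.[a] = - (phi B.[a] * phi b).
  by apply/eqP; rewrite -addr_eq0 -rmorphM -rmorphD AB0 rmorph0.
ring.
Qed.

(** The polynomial - f(s, b) / (s - a), where f(s, t) = 0 is the model.
    Its value at a is minus the partial derivative of f in s. *)
Definition tangent_quotient (q : {poly k}) :=
  be - al * b%:P - (b ^+ 2)%:P = q * ('X - a%:P).

Lemma tangent_quotient_ex : exists q, tangent_quotient q.
Proof.
suff /factor_theorem : root (be - al * b%:P - (b ^+ 2)%:P) a by [].
by rewrite /root !hornerE -on_model; apply/eqP; ring.
Qed.

(** The equation of the model, expanded around t = b. *)
Lemma tangent_relation q : tangent_quotient q ->
  (t - phi b) * (t + phi b + ev al) = ev q * (s - phi a).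
Proof.
move=> qE.
have -> : ev q * (s - phi a) = ev (q * ('X - a%:P)).
  by rewrite rmorphM /= map_polyXsubC !hornerE.
rewrite -qE !rmorphB rmorphM /= !map_polyC /= rmorphXn !hornerE -model; ring.
Qed.

Definition generates_maximal (u : K) : Prop :=
  [/\ u != 0, value u 0 & forall f, value f 0 -> exists g c, value g c /\ f = g * u].

(** The partial derivative in t does not vanish, so that t + b + al is
    invertible in tangent_relation and t - b is a multiple of s - a. *)
Lemma generates_maximal_s : b + b + al.[a] != 0 -> generates_maximal (s - phi a).
Proof.
move=> b0; have [q /tangent_relation tb] := tangent_quotient_ex.
have vd : value (t + phi b + ev al) (b + b + al.[a]).
  by apply: valueD (value_poly _); apply: valueD value_t (valueC b).
split.
- rewrite subr_eq0; apply/eqP => sa.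
  have := @free ('X - a%:P) 0; rewrite map_polyXsubC rmorph0 !hornerE sa subrr.
  by move=> [] // /eqP; rewrite polyXsubC_eq0.
- by rewrite -(subrr a); apply: valueB value_s (valueC a).
move=> f /value0_decomp[g [h [[c vg] [d vh] ->]]].
exists (g + h * (ev q / (t + phi b + ev al))); eexists; split.
  apply: valueD vg _; apply: valueM vh _; apply: valueM (value_poly _) _.
  exact: valueV vd.
have d0 := value_neq0 b0 vd.
rewrite mulrDl; congr (_ + _); rewrite -mulrA; congr (_ * _).
by apply/(mulIf d0); rewrite tb mulrAC divfK.
Qed.

(** The partial derivative in s does not vanish, so that s - a is a multiple of
    t - b by tangent_relation. *)
Lemma generates_maximal_t q : tangent_quotient q -> q.[a] != 0 ->
  generates_maximal (t - phi b).
Proof.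
move=> /tangent_relation tb q0.
have eq0 := value_neq0 q0 (value_poly q).
split.
- rewrite subr_eq0; apply/eqP => tb0.
  have := @free (- b%:P) 1; rewrite rmorphN rmorph1 /= map_polyC /= !hornerE -tb0 addNr.
  by move=> [] // _ /eqP; rewrite oner_eq0.
- by rewrite -(subrr b); apply: valueB value_t (valueC b).
move=> f /value0_decomp[g [h [[c vg] [d vh] ->]]].
exists (g * ((t + phi b + ev al) / ev q) + h); eexists; split.
  apply: valueD vh; apply: valueM vg _; apply: valueM; last exact: valueV (value_poly q).
  by apply: valueD (value_poly _); apply: valueD value_t (valueC b).
rewrite mulrDl; congr (_ + _); rewrite -mulrA; congr (_ * _).
by apply/(mulIf eq0); rewrite [RHS]mulrAC divfK // [RHS]mulrC tb mulrC.
Qed.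
End PlaneModel.

(** * The two charts of the curve *)

Section CurveModels.
Variables (k K : fieldType) (phi : {rmorphism k -> K}) (x y : K) (l : nat).
Hypothesis l_odd : odd l.
Hypothesis l_gt1 : (1 < l)%N.
Local Notation ev A := (map_poly phi A).[x].
Hypothesis curve : y ^+ 2 + y = x ^+ l.
Hypothesis free : forall A B : {poly k}, ev A + ev B * y = 0 -> A = 0 /\ B = 0.

Local Notation value_aff := (value phi x y).
Local Notation h := l.+1./2.
Local Notation w := (y / x ^+ h).
Local Notation value_inf := (value phi x^-1 w 0 0).

Lemma double_half : (h + h = l.+1)%N.
Proof. by have := odd_double_half l.+1; rewrite /= l_odd -addnn. Qed.

Lemma half_gt1 : (1 < h)%N.
Proof. have := double_half; lia. Qed.

Lemma aff_model : y ^+ 2 + (map_poly phi 1).[x] * y = (map_poly phi 'X^l).[x].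
Proof. by rewrite rmorph1 map_polyXn !hornerE. Qed.

Lemma aff_on_model (a b : k) : b ^+ 2 + b = a ^+ l ->
  b ^+ 2 + (1 : {poly k}).[a] * b = ('X^l).[a].
Proof. by rewrite !hornerE. Qed.

Lemma x_neq0 : x != 0.
Proof.
apply/eqP => x0; have := @free 'X 0.
rewrite map_polyX rmorph0 !hornerE x0 => -[] // /eqP.
by rewrite polyX_eq0.
Qed.

(** The reciprocal polynomial turns polynomials in 1 / x into polynomials in x,
    which reduces the freeness at infinity to the affine one. *)
Lemma ev_reverse N (A : {poly k}) : (size A <= N.+1)%N ->
  ev (\poly_(i < N.+1) A`_(N - i)) = x ^+ N * (map_poly phi A).[x^-1].
Proof.
move=> sA; rewrite (@horner_coef_wide _ N.+1 (map_poly phi A)); last first.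
  by rewrite (leq_trans (size_poly _ _)).
rewrite (@horner_coef_wide _ N.+1); last first.
  by rewrite (leq_trans (size_poly _ _)) ?size_poly.
rewrite (reindex_inj rev_ord_inj) mulr_sumr; apply: eq_bigr => i _ /=.
have iN : (i <= N)%N by rewrite -ltnS.
rewrite !coef_map coef_poly /= subSS ltnS leq_subr subKn //.
by rewrite mulrCA exprVn expfB_cond ?(negPf x_neq0).
Qed.

Lemma reverse_eq0 N (A : {poly k}) : (size A <= N.+1)%N ->
  \poly_(i < N.+1) A`_(N - i) = 0 -> A = 0.
Proof.
move=> sA /polyP A0; apply/polyP => i; rewrite coef0.
have [iN|Ni] := leqP i N; last by rewrite nth_default // (leq_trans sA).
by have := A0 (N - i)%N; rewrite coef_poly coef0 ltnS leq_subr subKn.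
Qed.

Lemma inf_free (A B : {poly k}) :
  (map_poly phi A).[x^-1] + (map_poly phi B).[x^-1] * w = 0 -> A = 0 /\ B = 0.
Proof.
move=> AB0; pose N := maxn (size A) (size B).
have sA : (size A <= N.+1)%N by rewrite leqW ?leq_maxl.
have sB : (size B <= N.+1)%N by rewrite leqW ?leq_maxr.
have xh : x ^+ h != 0 by rewrite expf_neq0 ?x_neq0.
have := @free (\poly_(i < N.+1) A`_(N - i) * 'X^h) (\poly_(i < N.+1) B`_(N - i)).
rewrite rmorphM /= map_polyXn hornerM hornerXn !ev_reverse //.
have -> : x ^+ N * (map_poly phi A).[x^-1] * x ^+ h
  + x ^+ N * (map_poly phi B).[x^-1] * y
  = x ^+ N * x ^+ h * ((map_poly phi A).[x^-1] + (map_poly phi B).[x^-1] * w).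
  rewrite mulrDr; congr (_ + _); first by rewrite mulrAC.
  by rewrite [RHS]mulrACA [X in _ = _ * X]mulrC divfK.
rewrite AB0 mulr0 => -[] // /eqP; rewrite mulf_eq0 expf_eq0 polyX_eq0 andbF orbF.
by move=> /eqP /(reverse_eq0 sA) -> /(reverse_eq0 sB).
Qed.

Lemma inf_on_model : (0 : k) ^+ 2 + ('X^h).[0] * 0 = ('X : {poly k}).[0].
Proof. by rewrite !hornerE expr0n. Qed.

(** The equation of the curve divided by x^(l + 1), as 2 h = l + 1. *)
Lemma inf_model :
  w ^+ 2 + (map_poly phi 'X^h).[x^-1] * w = (map_poly phi 'X).[x^-1].
Proof.
have x0 := x_neq0; have xh : x ^+ h != 0 by rewrite expf_neq0.
rewrite map_polyXn map_polyX hornerXn hornerX.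
have xx : x ^+ h * x ^+ h = x ^+ l * x by rewrite -exprD double_half exprSr.
apply: (mulIf xh); apply: (mulIf xh); rewrite -[in RHS]mulrA xx.
rewrite exprVn; have -> : x^-1 * (x ^+ l * x) = x ^+ l by rewrite mulrC mulfK.
by rewrite -curve; field.
Qed.

(** None stands for the point at infinity, which lies on the curve. *)
Definition on_curve (P : option (k * k)) : Prop :=
  if P is Some (a, b) then b ^+ 2 + b = a ^+ l else True.

Definition value_at (P : option (k * k)) : K -> k -> Prop :=
  if P is Some (a, b) then value_aff a b else value_inf.

Definition generates_at (P : option (k * k)) : K -> Prop :=
  if P is Some (a, b) then generates_maximal phi x y a b
  else generates_maximal phi x^-1 w 0 0.

Lemma value_atC P c : value_at P (phi c) c.
Proof. by case: P => [[a b]|]; apply: valueC. Qed.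

Lemma value_at1 P : value_at P 1 1.
Proof. by case: P => [[a b]|]; apply: value1. Qed.

Lemma value_at0 P : value_at P 0 0.
Proof. by case: P => [[a b]|]; apply: value0. Qed.

Lemma value_atM P f g c d :
  value_at P f c -> value_at P g d -> value_at P (f * g) (c * d).
Proof. by case: P => [[a b]|]; apply: valueM. Qed.

Lemma value_atX P f c n : value_at P f c -> value_at P (f ^+ n) (c ^+ n).
Proof. by case: P => [[a b]|]; apply: valueX. Qed.

Lemma value_atV P f c : c != 0 -> value_at P f c -> value_at P f^-1 c^-1.
Proof. by case: P => [[a b]|]; apply: valueV. Qed.

Lemma value_atN P f c : value_at P f c -> value_at P (- f) (- c).
Proof. by case: P => [[a b]|]; apply: valueN. Qed.

Lemma value_atD P f g c d : on_curve P ->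
  value_at P f c -> value_at P g d -> value_at P (f + g) (c + d).
Proof.
case: P => [[a b] ab|_] /=; first exact: (valueD aff_model free (aff_on_model ab)).
exact: (valueD inf_model inf_free inf_on_model).
Qed.

Lemma value_atB P f g c d : on_curve P ->
  value_at P f c -> value_at P g d -> value_at P (f - g) (c - d).
Proof. by move=> P_on vf vg; apply: value_atD => //; apply: value_atN. Qed.

Lemma value_at_unique P f c d : on_curve P ->
  value_at P f c -> value_at P f d -> c = d.
Proof.
case: P => [[a b] ab|_] /=; first exact: (value_unique aff_model free (aff_on_model ab)).
exact: (value_unique inf_model inf_free inf_on_model).
Qed.

Lemma value_at_neq0 P f c : on_curve P -> c != 0 -> value_at P f c -> f != 0.
Proof.
move=> P_on c0 vf; apply: contra_neq c0 => f0.
by apply: value_at_unique P_on vf _; rewrite f0; apply: value_at0.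
Qed.

Lemma value_at_poly a b (A : {poly k}) : on_curve (Some (a, b)) ->
  value_at (Some (a, b)) (ev A) A.[a].
Proof. move=> ab; exact: (value_poly aff_model free (aff_on_model ab)). Qed.

Lemma value_at_y a b : value_at (Some (a, b)) y b.
Proof. exact: value_t. Qed.

Lemma value_at_line a b (A B : {poly k}) : on_curve (Some (a, b)) ->
  value_at (Some (a, b)) (ev A + ev B * y) (A.[a] + B.[a] * b).
Proof.
move=> P_on; apply: value_atD => //; first exact: value_at_poly.
by apply: value_atM; [exact: value_at_poly | exact: value_at_y].
Qed.

Lemma value_at_w : value_at None w 0.
Proof. exact: value_t. Qed.

(** So x has a pole of order two at infinity, w being a uniformizer there. *)
Lemma xw2E : x * w ^+ 2 = 1 - x^-1 ^+ h.-1 * w.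
Proof.
have x0 := x_neq0.
have := inf_model; rewrite map_polyXn map_polyX hornerXn hornerX.
move/(canRL (addrK _)) ->; rewrite mulrBr divff // mulrA; congr (_ - _ * _).
by rewrite -{1}(prednK (ltnW half_gt1)) exprS mulVKf.
Qed.

Lemma value_at_xw2 : value_at None (x * w ^+ 2) 1.
Proof.
have -> : 1 = 1 - 0 ^+ h.-1 * 0 :> k by rewrite mulr0 subr0.
rewrite xw2E; apply: value_atB => //; first exact: value_at1.
by apply: value_atM; [apply: value_atX; exact: value_s | exact: value_at_w].
Qed.

(** So y has a pole of order l at infinity. *)
Lemma yw_lE : y * w ^+ l = (x * w ^+ 2) ^+ h.
Proof.
have xh : x ^+ h != 0 by rewrite expf_neq0 ?x_neq0.
rewrite -{1}(divfK xh y) mulrAC -exprS [LHS]mulrC.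
by rewrite [RHS]exprMn -[(w ^+ 2) ^+ h]exprM mul2n -addnn double_half.
Qed.

Lemma value_at_ywl : value_at None (y * w ^+ l) 1.
Proof. by rewrite yw_lE -(expr1n _ h); apply: value_atX value_at_xw2. Qed.

Lemma generates_at_inf : generates_at None w.
Proof.
have := @generates_maximal_t _ _ _ _ _ _ _ inf_model inf_free 0 0 inf_on_model 1.
rewrite rmorph0 subr0; apply; last by rewrite hornerC oner_neq0.
by rewrite /tangent_quotient mulr0 expr0n /= subr0 subr0 mul1r.
Qed.

Lemma generates_at_x a b : on_curve (Some (a, b)) -> b + b + 1 != 0 ->
  generates_at (Some (a, b)) (x - phi a).
Proof.
move=> ab b0; apply: (generates_maximal_s aff_model free (aff_on_model ab)).
by rewrite hornerC.
Qed.

(** Where 2 b + 1 = 0 the curve is smooth because l a^(l - 1) <> 0, with y - b as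
    a uniformizer, and x - a has a double zero since y + b + 1 = y - b. *)
Lemma branch_point a b : l%:R != 0 :> k -> on_curve (Some (a, b)) -> b + b + 1 = 0 ->
  generates_at (Some (a, b)) (y - phi b) /\
  exists q : {poly k}, q.[a] != 0 /\ (y - phi b) ^+ 2 = ev q * (x - phi a).
Proof.
move=> l0 ab b0.
have [q qE] := tangent_quotient_ex (aff_on_model ab).
have tb := tangent_relation aff_model qE.
have q0 : q.[a] != 0.
  have := congr1 (fun p : {poly k} => p^`().[a]) qE.
  rewrite !derivE /= !hornerE /= subrr hornerMn hornerXn mulr0 !subr0 add0r => <-.
  rewrite -mulr_natr mulf_neq0 // expf_neq0 //; apply: contra_eq_neq b0 => a0.
  have : b * (b + 1) = 0 by rewrite mulrDr mulr1 -expr2 ab a0 expr0n; case: (l) l_gt1.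
  move=> /eqP; rewrite mulf_eq0 addr_eq0 => /orP[] /eqP ->.
    by rewrite !add0r oner_neq0.
  by rewrite addrNK oppr_eq0 oner_neq0.
split; first exact: (generates_maximal_t aff_model free (aff_on_model ab) qE).
exists q; split=> //; rewrite -tb rmorph1 hornerC expr2 -addrA; congr (_ * _).
have -> : phi b + 1 = - phi b.
  by apply/eqP; rewrite -addr_eq0 addrAC -(rmorph1 phi) -!rmorphD b0 rmorph0.
by [].
Qed.

Lemma generates_at_ex P : l%:R != 0 :> k -> on_curve P -> exists u, generates_at P u.
Proof.
move=> l0; case: P => [[a b] ab|_]; last by exists w; apply: generates_at_inf.
have [b0|b0] := eqVneq (b + b + 1) 0; last by exists (x - phi a); apply: generates_at_x.
by exists (y - phi b); have [] := branch_point l0 ab b0.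
Qed.

(** * Poles at infinity *)

Lemma ev_MXaddC (A : {poly k}) c : ev (A * 'X + c%:P) = ev A * x + phi c.
Proof. by rewrite rmorphD rmorphM /= map_polyX map_polyC !hornerE. Qed.

(** The term of degree i contributes a multiple of w^(2 (N - i)), by xw2E. *)
Lemma value_at_inf_poly N (A : {poly k}) : (size A <= N.+1)%N ->
  value_at None (ev A * w ^+ N.*2) A`_N.
Proof.
elim/poly_ind: A N => [|A c IH] N sA.
  by rewrite rmorph0 horner0 mul0r coef0; apply: value_at0.
have coef_S i : (A * 'X + c%:P)`_i.+1 = A`_i by rewrite coefD coefMX coefC addr0.
have coef_0 : (A * 'X + c%:P)`_0 = c by rewrite coefD coefMX coefC add0r.
case: N sA => [|N] sA.
  rewrite coef_0 (size1_polyC sA) coef_0 map_polyC hornerC mulr1.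
  exact: value_atC.
have sA1 : (size A <= N.+1)%N.
  by move: sA; rewrite size_MXaddC; case: ifP => // /andP[/eqP->]; rewrite size_poly0.
have -> : ev (A * 'X + c%:P) * w ^+ N.+1.*2
    = ev A * w ^+ N.*2 * (x * w ^+ 2) + phi c * w ^+ N.*2.+1 * w.
  rewrite ev_MXaddC mulrDl doubleS -addn2 exprD -!mulrA; congr (_ * _ + _ * _).
    by rewrite mulrCA.
  by rewrite -exprD addn2 -exprSr.
rewrite coef_S -(mulr1 A`_N) -[A`_N * 1]addr0 -{2}[0](mulr0 (c * 0)).
apply: value_atD => //; first by apply: value_atM (IH N sA1) value_at_xw2.
apply: value_atM value_at_w; apply: value_atM; first exact: value_atC.
by have := value_atX N.*2.+1 value_at_w; rewrite expr0n.
Qed.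

Lemma value_at_inf_drop f c i j :
  value_at None (f * w ^+ i) c -> (i < j)%N -> value_at None (f * w ^+ j) 0.
Proof.
move=> vf ij; rewrite -(subnKC ij) addSnnS exprD mulrA -(mulr0 c).
by apply: value_atM vf _; have := value_atX (j - i.+1).+1 value_at_w; rewrite expr0n.
Qed.

Definition pole_degree (A B : {poly k}) : nat :=
  if B == 0 then (size A).-1.*2 else maxn (size A).-1.*2 ((size B).-1.*2 + l).

Lemma pole_at_infinity (A B : {poly k}) : (A != 0) || (B != 0) ->
  exists2 c, c != 0 & value_at None ((ev A + ev B * y) * w ^+ pole_degree A B) c.
Proof.
move=> AB0.
have vA N : ((size A).-1 <= N)%N -> value_at None (ev A * w ^+ N.*2) A`_N.
  by move=> sA; apply: value_at_inf_poly; lia.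
have vB N : ((size B).-1 <= N)%N -> value_at None (ev B * y * w ^+ (N.*2 + l)) B`_N.
  move=> sB; rewrite exprD mulrACA -[B`_N]mulr1.
  by apply: value_atM value_at_ywl; apply: value_at_inf_poly; lia.
rewrite /pole_degree; have [B0|B0] := eqVneq B 0.
  move: AB0; rewrite B0 eqxx orbF => A0; exists (lead_coef A); rewrite ?lead_coef_eq0 //.
  by rewrite rmorph0 horner0 mul0r addr0; apply: vA.
have := vA _ (leqnn _); have := vB _ (leqnn _).
set dA := (size A).-1; set dB := (size B).-1 => {}vB {}vA.
case: (ltngtP dA.*2 (dB.*2 + l)) => dAB.
- exists (lead_coef B); rewrite ?lead_coef_eq0 // mulrDl -[lead_coef B]add0r.
  by apply: value_atD => //; apply: value_at_inf_drop vA dAB.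
- exists (lead_coef A); first
    by move: dAB; rewrite /dA; case: (eqVneq A 0) => [->|]; rewrite ?size_poly0 ?lead_coef_eq0.
  by rewrite mulrDl -[lead_coef A]addr0; apply: value_atD => //; apply: value_at_inf_drop vB dAB.
(* The pole orders 2 deg A and 2 deg B + l have different parities. *)
by have := congr1 odd dAB; rewrite oddD !odd_double l_odd.
Qed.


Lemma pole_degree_unique (A B : {poly k}) m c : c != 0 ->
  value_at None ((ev A + ev B * y) * w ^+ m) c -> pole_degree A B = m.
Proof.
move=> c0 vm; have f0 : (A != 0) || (B != 0).
  rewrite -negb_and; apply: contra_neqN (value_at_neq0 (P := None) I c0 vm) => /andP[/eqP-> /eqP->].
  by rewrite !rmorph0 !horner0 mul0r addr0 mul0r.
have [d d0 vd] := pole_at_infinity f0.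
case: (ltngtP (pole_degree A B) m) => // cmp.
  by move: c0; rewrite (value_at_unique (P := None) I vm (value_at_inf_drop vd cmp)) eqxx.
by move: d0; rewrite (value_at_unique (P := None) I vd (value_at_inf_drop vm cmp)) eqxx.
Qed.

(** The norm A^2 - A B - B^2 x^l has degree max (2 deg A, 2 deg B + l): the two
    integers have different parities and dominate deg A + deg B. *)
Lemma pole_degree_norm (A B : {poly k}) c a n : c != 0 ->
    A ^+ 2 - A * B - B ^+ 2 * 'X^l = c *: ('X - a%:P) ^+ n ->
  pole_degree A B = n.
Proof.
move=> c0 /(congr1 (fun p : {poly k} => size p)); rewrite size_scale // size_exp_XsubC.
have size_mul (p q : {poly k}) : p != 0 -> q != 0 -> size (p * q) = (size p + size q).-1.
  exact: size_mul.
have size_D (p q : {poly k}) : (size (p + q)%R <= maxn (size p) (size q))%N.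
  exact: size_polyD.
have size_N (p : {poly k}) : size (- p) = size p by apply: size_polyN.
have size_Dl (p q : {poly k}) : (size q < size p)%N -> size (p + q) = size p.
  exact: size_polyDl.
rewrite /pole_degree -!addnn; have [->|B0] := eqVneq B 0.
  rewrite mulr0 expr0n mul0r !subr0 expr2.
  have [->|A0] := eqVneq A 0; first by rewrite mulr0 size_poly0.
  rewrite size_mul //; move: A0; rewrite -size_poly_gt0; lia.
have sB : (size B > 0)%N by rewrite size_poly_gt0.
have sBX : size (B ^+ 2 * 'X^l) = (size B + size B + l).-1.
  rewrite size_Mmonic ?expf_neq0 ?monicXn // size_polyXn expr2 size_mul //; lia.
have sAB : (size (A * B)%R <= (size A + size B).-1)%N by apply: size_polyMleq.
have sAA : size (A ^+ 2) = (size A + size A).-1.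
  rewrite expr2; have [->|A0] := eqVneq A 0; last exact: size_mul.
  by rewrite mulr0 size_poly0.
(* No cancellation of leading terms: 2 deg A is even, 2 deg B + l is odd. *)
have odd_ne : (size A + size A)%N <> (size B + size B + l)%N.
  by move=> /(congr1 odd); rewrite !oddD !addbb l_odd.
move: (A ^+ 2) (A * B) (B ^+ 2 * 'X^l) sAA sAB sBX => P M Q sP sM sQ.
have [lt_AB|le_BA] := ltnP (size A + size A) (size B + size B + l).
  have := size_D P (- M); rewrite size_N sP => sPM.
  have -> : P - M - Q = - Q + (P - M) by rewrite addrC.
  by rewrite size_Dl size_N sQ; [lia | apply: leq_ltn_trans sPM _; lia].
have := size_D (- M) (- Q); rewrite !size_N sQ => sMQ.
have -> : P - M - Q = P + (- M - Q) by rewrite addrA.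
by rewrite size_Dl sP; [lia | apply: leq_ltn_trans sMQ _; lia].
Qed.

(** * Orders of functions *)

Hypothesis l_neq0 : l%:R != 0 :> k.

Definition order_at (P : option (k * k)) (f : K) (n : int) : Prop :=
  forall u, generates_at P u -> exists2 c, c != 0 & value_at P (f / u ^ n) c.

Lemma generates_at_neq0 P u : generates_at P u -> u != 0.
Proof. by case: P => [[a b]|] []. Qed.

Lemma generates_at_value P u : generates_at P u -> value_at P u 0.
Proof. by case: P => [[a b]|] []. Qed.

Lemma generates_at_div P u f : generates_at P u -> value_at P f 0 ->
  exists g c, value_at P g c /\ f = g * u.
Proof. by case: P => [[a b]|] [_ _]; apply. Qed.

Lemma value_at_exprz P f c (n : int) : c != 0 -> value_at P f c ->
  value_at P (f ^ n) (c ^ n).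
Proof.
move=> c0 vf; case: n => n; first exact: value_atX.
by apply: value_atV; [rewrite expf_neq0 | apply: value_atX].
Qed.

(** All uniformizers are equivalent, so that one of them is enough. *)
Lemma order_atI P f n u c : on_curve P -> generates_at P u -> c != 0 ->
  value_at P (f / u ^ n) c -> order_at P f n.
Proof.
move=> P_on gu c0 vf v gv.
have [g [d [vg uE]]] := generates_at_div gv (generates_at_value gu).
have [g' [d' [vg' vE]]] := generates_at_div gu (generates_at_value gv).
have u0 := generates_at_neq0 gu; have v0 := generates_at_neq0 gv.
(* Two generators differ by a unit. *)
have gg' : g * g' = 1.
  by apply: (mulIf u0); rewrite -mulrA -vE -uE mul1r.
have d0 : d != 0.
  have := value_at_unique P_on (value_atM vg vg'); rewrite gg' => /(_ _ (value_at1 P)) dd'.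
  by apply: contra_eq_neq dd' => ->; rewrite mul0r eq_sym oner_neq0.
exists (c * d ^ n); first by rewrite mulf_neq0 // expfz_neq0.
have -> : f / v ^ n = f / u ^ n * g ^ n.
  have gE : g = u / v by rewrite uE mulfK.
  by rewrite gE expfzMl exprz_inv mulrA divfK ?expfz_neq0 // -invr_expz.
by apply: value_atM vf _; apply: value_at_exprz.
Qed.

Lemma order_atV P f n : order_at P f n -> order_at P f^-1 (- n).
Proof.
move=> ordf u gu; have [c c0 vc] := ordf u gu; exists c^-1; first by rewrite invr_eq0.
by rewrite -invr_expz -invfM; apply: value_atV.
Qed.

Lemma order_at0 P f c : on_curve P -> c != 0 -> value_at P f c -> order_at P f 0.
Proof.
move=> P_on c0 vf u gu; exists c => //; by rewrite expr0z divr1.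
Qed.

Lemma order_at_regular P f (n : nat) : on_curve P -> order_at P f n ->
  exists2 c, value_at P f c & (0 < n)%N -> c = 0.
Proof.
move=> P_on ordf; have [u gu] := generates_at_ex l_neq0 P_on.
have [c c0 vc] := ordf u gu.
exists (c * 0 ^+ n); last by case: n {ordf vc} => // n; rewrite expr0n mulr0.
rewrite -(divfK (expf_neq0 n (generates_at_neq0 gu)) f).
by apply: value_atM vc _; apply: value_atX; apply: generates_at_value.
Qed.

(** * Functions with a zero of high order at one point *)

(** The multiplicities of n ([Q] - [oo]), for Q affine. *)
Definition single_zero (Q : option (k * k)) (n : nat) (P : option (k * k)) : int :=
  if P == Q then n%:Z else if P == None then - n%:Z else 0.

(** The norm of f = A(x) + B(x) y vanishes only over a, so that f is a unit at
    every other affine point; at the conjugate of (a, b) it is a unit by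
    hypothesis, and at (a, b) its conjugate is one, which leaves the whole zero of
    the norm to f. At infinity pole_degree_norm applies. *)
Lemma order_at_single a b (A B : {poly k}) c n : on_curve (Some (a, b)) -> (0 < n)%N -> c != 0 ->
    A ^+ 2 - A * B - B ^+ 2 * 'X^l = c *: ('X - a%:P) ^+ n ->
    A.[a] - B.[a] - B.[a] * b != 0 ->
  forall P, on_curve P ->
  order_at P (ev A + ev B * y)
    (single_zero (Some (a, b)) n P).
Proof.
move=> ab n_gt0 c0 norm conj0.
(* g is the conjugate of f under y -> - 1 - y. *)
set f := ev A + ev B * y; pose g := ev (A - B) + ev (- B) * y.
have fg : f * g = phi c * (x - phi a) ^+ n.
  have := congr1 (fun p : {poly k} => ev p) norm.
  rewrite /= !(rmorphB, rmorphM, rmorphXn) /= map_polyZ /= rmorphXn /= map_polyXsubC.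
  rewrite map_polyX !hornerE => <-.
  rewrite -curve /f /g rmorphB rmorphN !hornerE; ring.
have fb0 : A.[a] + B.[a] * b = 0.
  have := value_atM (value_at_line A B ab) (value_at_line (A - B) (- B) ab).
  rewrite -/f -/g fg => vfg; have := value_at_unique ab vfg.
  have v0 : value_at (Some (a, b)) (phi c * (x - phi a) ^+ n) (c * (a - a) ^+ n).
    apply: value_atM; first exact: value_atC.
    apply: value_atX; apply: (value_atB ab); [exact: value_s | exact: value_atC].
  move=> /(_ _ v0); rewrite subrr expr0n (gtn_eqF n_gt0) mulr0 => /eqP.
  rewrite mulf_eq0 !hornerE mulNr (negPf conj0) orbF => /eqP; exact.
have b0 : b + b + 1 != 0.
  apply: contraNneq conj0 => bb1.
  have -> : A.[a] - B.[a] - B.[a] * b = A.[a] + B.[a] * b - B.[a] * (b + b + 1) by ring.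
  by rewrite fb0 bb1 mulr0 subr0.
case=> [[a' b']|] P_on.
  rewrite /single_zero; have vf := value_at_line A B P_on; have vg := value_at_line (A - B) (- B) P_on.
  have [[aE bE]|P_ne] := eqVneq (Some (a', b')) (Some (a, b)).
    rewrite aE bE in P_on vf vg *.
    have gE : (A - B).[a] + (- B).[a] * b = A.[a] - B.[a] - B.[a] * b.
      by rewrite !hornerE mulNr.
    rewrite gE in vg; apply: (order_atI ab (generates_at_x ab b0) (c := c / (A.[a] - B.[a] - B.[a] * b))).
      by rewrite mulf_neq0 // invr_eq0.
    have -> : f / (x - phi a) ^ n = phi c / g.
      have g0 := value_at_neq0 ab conj0 vg.
      have u0 := generates_at_neq0 (generates_at_x ab b0).
      by apply/eqP; rewrite eqr_div ?expf_neq0 // fg.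
    by apply: value_atM (value_atC _ _) _; apply: value_atV.
  apply: (order_at0 P_on _ vf).
  have [aE|a_ne] := eqVneq a' a.
    have b'E : b' = - 1 - b.
      have : (b' - b) * (b' + b + 1) = 0.
        have -> : (b' - b) * (b' + b + 1) = (b' ^+ 2 + b') - (b ^+ 2 + b) by ring.
        by rewrite P_on ab aE subrr.
      move=> /eqP; rewrite mulf_eq0 subr_eq0 => /orP[/eqP bE|].
        by move: P_ne; rewrite aE bE eqxx.
      by rewrite -addrA addr_eq0 => /eqP ->; ring.
    rewrite aE b'E; move: conj0; apply: contra_neq => <-; ring.
  have vp : value_at (Some (a', b')) (phi c * (x - phi a) ^+ n) (c * (a' - a) ^+ n).
    apply: value_atM; first exact: value_atC.
    apply: value_atX; apply: (value_atB P_on); [exact: value_s | exact: value_atC].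
  have := value_at_unique P_on (value_atM vf vg); rewrite -/f -/g fg => /(_ _ vp) E.
  have : c * (a' - a) ^+ n != 0 by rewrite mulf_neq0 // expf_neq0 // subr_eq0.
  by rewrite -E mulf_eq0 negb_or => /andP[].
have AB0 : (A != 0) || (B != 0).
  rewrite -negb_and; apply: contraNN conj0 => /andP[/eqP-> /eqP->].
  by rewrite !horner0 mul0r !subr0.
have [d d0] := pole_at_infinity AB0; rewrite (pole_degree_norm c0 norm) => vf.
apply: (order_atI (P := None) I generates_at_inf d0).
by rewrite /single_zero /= -invr_expz invrK.
Qed.

(** (a, b) is the only point over a, and x - a has a double zero there. *)
Lemma order_at_branch a b m : on_curve (Some (a, b)) -> (0 < m)%N -> b + b + 1 = 0 ->
  forall P, on_curve P ->
  order_at P ((x - phi a) ^+ m)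
    (single_zero (Some (a, b)) m.*2 P).
Proof.
move=> ab m_gt0 b0.
have [gu [q [q0 qE]]] := branch_point l_neq0 ab b0.
case=> [[a' b']|] P_on.
  rewrite /single_zero; have [[aE bE]|P_ne] := eqVneq (Some (a', b')) (Some (a, b)).
    rewrite aE bE; apply: (order_atI ab gu); last first.
      have -> : (x - phi a) ^+ m / (y - phi b) ^ m.*2%:Z = (ev q)^-1 ^+ m.
        rewrite -mul2n -[LHS]/(_ / _ ^+ _) exprM qE.
        rewrite exprMn invfM mulrCA divff ?mulr1 ?exprVn // expf_neq0 //.
        have := expf_neq0 2 (generates_at_neq0 gu); rewrite qE mulf_eq0 negb_or.
        by case/andP.
      by apply: value_atX; apply: value_atV q0 _; apply: value_at_poly.
    by rewrite expf_neq0 // invr_eq0.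
  apply: (order_at0 P_on (c := (a' - a) ^+ m)).
    rewrite expf_neq0 // subr_eq0; apply: contraNneq P_ne => aE; rewrite aE.
    have : (b' - b) * (b' - b) = 0.
      have -> : (b' - b) * (b' - b) = (b' ^+ 2 + b') - (b ^+ 2 + b) - (b' - b) * (b + b + 1) by ring.
      by rewrite P_on ab aE subrr b0 mulr0 subr0.
    by move=> /eqP; rewrite mulf_eq0 orbb subr_eq0 => /eqP ->.
  by apply: value_atX; apply: (value_atB P_on); [exact: value_s | exact: value_atC].
apply: (order_atI (P := None) I generates_at_inf (oner_neq0 k)).
rewrite -[single_zero _ _ _]/(- m.*2%:Z) -invr_expz invrK.
rewrite -[_ ^ _]/(_ ^+ _) -mul2n exprM -exprMn -(expr1n k m).
apply: value_atX; rewrite mulrBl -[1]subr0 -(mulr0 (a * 0)).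
apply: value_atB => //; first exact: value_at_xw2.
rewrite expr2 mulrA; apply: value_atM value_at_w.
by apply: value_atM value_at_w; apply: value_atC.
Qed.

(** * Two points are never linearly equivalent *)

Hypothesis closed : forall p : {poly k}, size p != 1%N -> exists a, root p a.
Hypothesis representation : forall f : K,
  exists A B D : {poly k}, D != 0 /\ f = (ev A + ev B * y) / ev D.

Lemma point_over a : exists b, on_curve (Some (a, b)).
Proof.
have sp : size ('X^2 + ('X - (a ^+ l)%:P) : {poly k}) = 3%N.
  by rewrite size_polyDl ?size_polyXn // size_XsubC.
have [|b] := closed (p := 'X^2 + ('X - (a ^+ l)%:P)); first by rewrite sp.
by rewrite /root !hornerE subr_eq0 => /eqP; exists b.
Qed.

Lemma conj_on_curve a b : on_curve (Some (a, b)) -> on_curve (Some (a, -1 - b)).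
Proof. by rewrite /on_curve => <-; ring. Qed.

Lemma ev_eq0 (A : {poly k}) : (ev A == 0) = (A == 0).
Proof.
apply/eqP/eqP => [A0|->]; last by rewrite rmorph0 horner0.
by have [] := @free A 0; rewrite // A0 rmorph0 horner0 mul0r addr0.
Qed.

Lemma ev_factor (A : {poly k}) a : root A a ->
  exists2 A1, A = A1 * ('X - a%:P) & ev A = ev A1 * (x - phi a).
Proof.
move=> /factor_theorem[A1 ->]; exists A1 => //.
by rewrite rmorphM /= map_polyXsubC !hornerE.
Qed.

Lemma value_at_xB a b c : on_curve (Some (a, b)) ->
  value_at (Some (a, b)) (x - phi c) (a - c).
Proof. by move=> ab; apply: (value_atB ab); [exact: value_s | exact: value_atC]. Qed.

(** Multiplying f by the denominator shows that the numerator A(x) + B(x) y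
    vanishes at the points over a. When there are two of them, A and B vanish at
    a; when there is only one, the numerator vanishes doubly there. *)
Lemma regular_numerator_root f (A B D1 : {poly k}) a :
    (forall b, on_curve (Some (a, b)) -> exists c, value_at (Some (a, b)) f c) ->
    f * (ev D1 * (x - phi a)) = ev A + ev B * y ->
  root A a /\ root B a.
Proof.
move=> freg fE.
have vanish b : on_curve (Some (a, b)) -> A.[a] + B.[a] * b = 0.
  move=> ab; have [c vc] := freg b ab.
  have v0 := value_atM vc (value_atM (value_at_poly D1 ab) (value_at_xB a ab)).
  rewrite fE subrr !mulr0 in v0.
  exact: value_at_unique ab (value_at_line A B ab) v0.
have [b ab] := point_over a.
have E := vanish b ab.
suff B0 : B.[a] = 0 by split; apply/rootP; rewrite ?B0 //; move: E; rewrite B0 mul0r addr0.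
have [b0|b0] := eqVneq (b + b + 1) 0; last first.
  have E' := vanish _ (conj_on_curve ab).
  have : B.[a] * (b + b + 1) = 0.
    have -> : B.[a] * (b + b + 1) = (A.[a] + B.[a] * b) - (A.[a] + B.[a] * (-1 - b)) by ring.
    by rewrite E E' subrr.
  by move=> /eqP; rewrite mulf_eq0 (negPf b0) orbF => /eqP.
(* Only one point lies over a, where A + B b vanishes; that x - a has a double
   zero there gives the second condition B(a) = 0. *)
have [gu [q [q0 qE]]] := branch_point l_neq0 ab b0.
have [C1 _ CE] : exists2 C1, A + B * b%:P = C1 * ('X - a%:P) & ev (A + B * b%:P) = ev C1 * (x - phi a).
  by apply: ev_factor; apply/rootP; rewrite !hornerE.
have [c vc] := freg b ab.
set u := y - phi b in gu qE; have u0 := generates_at_neq0 gu.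
have BqE : ev B * ev q = (f * ev D1 - ev C1) * u.
  apply: (mulIf u0); rewrite -[in RHS]mulrA -expr2 qE.
  have : (f * ev D1 - ev C1) * (x - phi a) = ev B * u.
    rewrite mulrBl -mulrA fE -CE rmorphD rmorphM /= map_polyC !hornerE /u; ring.
  by move=> E1; rewrite mulrCA E1; ring.
have := value_atM (value_at_poly B ab) (value_at_poly q ab); rewrite BqE => vBq.
have v0 : value_at (Some (a, b)) ((f * ev D1 - ev C1) * u) ((c * D1.[a] - C1.[a]) * 0).
  apply: value_atM (generates_at_value gu); apply: (value_atB ab); last exact: value_at_poly.
  by apply: value_atM vc _; apply: value_at_poly.
have /eqP := value_at_unique ab vBq v0.
by rewrite mulr0 mulf_eq0 (negPf q0) orbF => /eqP.
Qed.

(** The affine curve is normal: a zero of the denominator cancels against the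
    numerator by regular_numerator_root. *)
Lemma regular_everywhere f :
    (forall P, on_curve P -> P != None -> exists c, value_at P f c) ->
  exists A B : {poly k}, f = ev A + ev B * y.
Proof.
move=> freg; have [A [B [D [D0 fE]]]] := representation f.
have {fE} : f * ev D = ev A + ev B * y by rewrite fE divfK // ev_eq0.
elim: {D}_.+1 {-2}D (ltnSn (size D)) A B D0 => // n IH D sD A B D0 fE.
have [D1|D1] := eqVneq (size D) 1%N.
  have [d DE] : exists d, D = d%:P by exists D`_0; apply: size1_polyC; rewrite D1.
  exists (d^-1 *: A), (d^-1 *: B).
  have d0 : phi d != 0 by rewrite fmorph_eq0; apply: contraNneq D0 => d0; rewrite DE d0.
  apply: (mulIf d0); move: fE; rewrite DE map_polyC hornerC => ->.
  by rewrite !map_polyZ !hornerZ fmorphV /=; field.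
have [a /ev_factor[D2 DE DE2]] := closed D1.
have [||/ev_factor[A1 AE AE2] /ev_factor[B1 BE BE2]] := @regular_numerator_root f A B D2 a.
- by move=> b ab; apply: freg.
- by rewrite -DE2.
have xa0 : x - phi a != 0.
  by have := ev_eq0 ('X - a%:P); rewrite map_polyXsubC !hornerE polyXsubC_eq0 => ->.
have D20 : D2 != 0 by apply: contraNneq D0 => D20; rewrite DE D20 mul0r.
apply: (IH D2 _ A1 B1 D20).
  by move: sD; rewrite DE size_Mmonic ?monicXsubC // size_XsubC addn2.
by apply: (mulIf xa0); rewrite -mulrA -DE2 fE AE2 BE2; ring.
Qed.

Hypothesis l_gt2 : (2 < l)%N.

Lemma pole_degree_neq1 (A B : {poly k}) : pole_degree A B != 1%N.
Proof.
rewrite /pole_degree; case: ifP => _; first by case: _.-1.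
by rewrite neq_ltn orbC leq_max (leq_trans (ltnW l_gt2) (leq_addl _ _)) orbT.
Qed.

(** The pole orders at infinity of regular functions are 2 deg A and 2 deg B + l,
    never 1 since l >= 3: this is where the genus is positive. *)
Lemma no_simple_pole_inf Q f : on_curve (Some Q) ->
  ~ forall P, on_curve P -> order_at P f ((P == Some Q)%:Z - (P == None)%:Z).
Proof.
move=> Q_on ordf.
have [|A [B fE]] := @regular_everywhere f.
  case=> // -[a b] P_on _; have := ordf _ P_on; rewrite subr0 => /(order_at_regular P_on)[c vc _].
  by exists c.
have [c c0] := ordf None I w generates_at_inf.
rewrite [(None == Some Q)]/= sub0r -[(- _)%R]/(- 1%:Z) -invr_expz invrK expr1z => vc.
have := pole_degree_neq1 A B; rewrite (@pole_degree_unique _ _ 1 c) //.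
by rewrite expr1 -fE.
Qed.

(** When both points are affine, Q = (a', b'), multiplying by x - a' leads to a regular function with a
    pole of order two at infinity, that is a polynomial of degree one in x, and it
    vanishes at a'. *)
Lemma no_simple_pole P Q f : on_curve P -> on_curve Q -> P != Q ->
  ~ forall R, on_curve R -> order_at R f ((R == P)%:Z - (R == Q)%:Z).
Proof.
move=> P_on Q_on P_ne ordf.
case: P P_on P_ne ordf => [[a b]|] P_on P_ne ordf; last first.
  case: Q Q_on P_ne ordf => // Q Q_on _ ordf.
  apply: (no_simple_pole_inf (f := f^-1) Q_on) => R R_on.
  by rewrite -opprB; apply: order_atV; apply: ordf.
case: Q Q_on P_ne ordf => [[a' b'] Q_on P_ne ordf|_ _]; last exact: no_simple_pole_inf.
pose g := f * (x - phi a').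
have regf R : on_curve R -> R != Some (a', b') -> exists2 c, value_at R f c & R = Some (a, b) -> c = 0.
  move=> R_on /negPf R_ne; have := ordf R R_on; rewrite R_ne subr0 => /(order_at_regular R_on)[c vc c0].
  by exists c => // RE; apply: c0; rewrite RE eqxx.
have pole u : generates_at (Some (a', b')) u -> exists c, value_at (Some (a', b')) (f * u) c.
  move=> gu; have [c c0] := ordf _ Q_on u gu.
  rewrite eq_sym (negPf P_ne) eqxx sub0r -[(- _)%R]/(- 1%:Z) -invr_expz invrK expr1z => vc.
  by exists c.
have [|A [B gE]] := @regular_everywhere g.
  move=> R R_on R_ne; have [RE|R_neQ] := eqVneq R (Some (a', b')).
    have [u gu] := generates_at_ex l_neq0 Q_on; have [c vc] := pole u gu.
    have := value_at_xB a' Q_on; rewrite subrr => /(generates_at_div gu)[g0 [d [vd gE]]].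
    by exists (c * d); rewrite RE /g gE (mulrC g0) mulrA; apply: value_atM.
  have [c vc _] := regf R R_on R_neQ.
  case: R R_on R_ne R_neQ vc => // -[a1 b1] R_on _ _ vc.
  by exists (c * (a1 - a')); apply: value_atM vc (value_at_xB _ R_on).
(* The simple pole of f at (a', b') leaves a zero of f (x - a') at the
   conjugate point, which may be (a', b') itself. *)
have A_root : A.[a'] + B.[a'] * (-1 - b') = 0.
  have cQ := conj_on_curve Q_on.
  have [cE|c_ne] := eqVneq (Some (a', -1 - b')) (Some (a', b')).
    case: cE => cE; have b0 : b' + b' + 1 = 0 by rewrite -{1}cE; ring.
    have [gu [q [q0 qE]]] := branch_point l_neq0 Q_on b0.
    have [c vc] := pole _ gu.
    have := value_atM (value_at_line A B Q_on) (value_at_poly q Q_on).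
    rewrite -gE /g -mulrA (mulrC (x - _)) -qE expr2 mulrA => vl.
    have := value_at_unique Q_on vl (value_atM vc (generates_at_value gu)).
    by move/eqP; rewrite mulr0 mulf_eq0 (negPf q0) orbF cE => /eqP.
  have [c vc _] := regf _ cQ c_ne.
  have := value_at_unique cQ (value_at_line A B cQ) ; apply.
  by rewrite -gE /g -(mulr0 c); apply: value_atM vc _; have := value_at_xB a' cQ; rewrite subrr.
have vinf : exists2 c, c != 0 & value_at None (g * w ^+ 2) c.
  have [c c0] := ordf None I w generates_at_inf; rewrite subr0 expr0z divr1 => vc.
  exists (c * 1); first by rewrite mulr1.
  rewrite /g -mulrA; apply: value_atM vc _; rewrite mulrBl -[1]subr0 -(mulr0 (a' * 0)).
  apply: value_atB => //; first exact: value_at_xw2.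
  rewrite expr2 (mulrA (phi a') w); apply: value_atM value_at_w.
  by apply: value_atM value_at_w; apply: value_atC.
have [c c0 vc] := vinf; rewrite gE in vc; have := pole_degree_unique c0 vc.
rewrite /pole_degree; case: eqVneq => [B0 sA|_]; last first.
  move=> dg; have : (l <= 2)%N by rewrite -dg (leq_trans _ (leq_maxr _ _)) ?leq_addl.
  by rewrite leqNgt l_gt2.
have sA2 : size A = 2%N by move: sA; rewrite -addnn; move: (size A) => n; lia.
rewrite B0 horner0 mul0r addr0 in A_root.
have [A1 AE AE2] := ev_factor (introT rootP A_root).
have sA1 : size A1 = 1%N.
  have A10 : A1 != 0 by apply: contra_eq_neq sA2 => A10; rewrite AE A10 mul0r size_poly0.
  by move: sA2; rewrite AE size_Mmonic ?monicXsubC // size_XsubC addn2 => -[].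
have [d d0 A1E] : exists2 d, d != 0 & A1 = d%:P by apply/size_poly1P; rewrite sA1.
have xa0 : x - phi a' != 0.
  by have := ev_eq0 ('X - a'%:P); rewrite map_polyXsubC !hornerE polyXsubC_eq0 => ->.
have fE : f = phi d.
  apply: (mulIf xa0); rewrite -/g gE B0 rmorph0 horner0 mul0r addr0 AE2 A1E.
  by rewrite map_polyC hornerC.
have [e ve e0] := regf _ P_on P_ne.
have vd : value_at (Some (a, b)) f d by rewrite fE; apply: value_atC.
by move: d0; rewrite (value_at_unique P_on vd ve) e0 ?eqxx.
Qed.

End CurveModels.

(** * Norms along x = v^m and algebraically closed fields *)

Lemma coef_comp_scaleX (R : comNzRingType) (p : {poly R}) c i :
  (p \Po (c *: 'X))`_i = c ^+ i * p`_i.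
Proof.
rewrite coef_comp_poly.
under eq_bigr => j _ do rewrite exprZn coefZ coefXn.
have [ip|pi] := ltnP i (size p); last first.
  rewrite (nth_default _ pi) mulr0 big1 // => j _.
  by rewrite gtn_eqF ?mulr0 // (leq_trans (ltn_ord j)).
rewrite (bigD1 (Ordinal ip)) //= eqxx mulr1 mulrC big1 ?addr0 // => j j_ne.
by rewrite eq_sym (negPf j_ne : (val j == i) = false) !mulr0.
Qed.

Lemma scale_invariant_poly (R : idomainType) (m : nat) (z : R) (g : {poly R}) :
  m.-primitive_root z -> g \Po (z *: 'X) = g -> exists h, g = h \Po 'X^m.
Proof.
move=> z_prim g_inv; have m_gt0 := prim_order_gt0 z_prim.
have gi i : ~~ (m %| i)%N -> g`_i = 0.
  rewrite (prim_order_dvd z_prim) => zi.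
  have := congr1 (fun p : {poly R} => p`_i) g_inv; rewrite /= coef_comp_scaleX.
  by move=> /eqP; rewrite -subr_eq0 -[X in _ - X]mul1r -mulrBl mulf_eq0 subr_eq0 (negPf zi) => /eqP.
exists (\poly_(i < size g) g`_(i * m)); apply/polyP => i.
rewrite coef_comp_poly_Xn //; case: ifP => [/dvdnP[j ->]|/negbT/gi //].
rewrite mulnK // coef_poly; case: ltnP => // sj.
by rewrite nth_default // (leq_trans sj) ?leq_pmulr.
Qed.

(** The product is invariant under X -> z X, which permutes its factors, hence
    only involves powers of X^m. This is the norm from functions of v to functions
    of v^m. *)
Lemma scale_norm_poly (R : idomainType) (m : nat) (z : R) (g : {poly R}) :
  m.-primitive_root z ->
  exists h, h \Po 'X^m = \prod_(i < m) (g \Po (z ^+ i *: 'X)).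
Proof.
move=> z_prim; have zm := prim_expr_order z_prim.
have [|h ->] := @scale_invariant_poly _ m z (\prod_(i < m) (g \Po (z ^+ i *: 'X))) z_prim.
  rewrite rmorph_prod /=.
  under eq_bigr => i _ do
    rewrite -comp_polyA comp_polyZ comp_polyX scalerA -exprSr.
  case: m z_prim zm => [/prim_order_gt0 //|m] _ zm.
  by rewrite big_ord_recr [RHS]big_ord_recl mulrC zm expr0.
by exists h.
Qed.

Lemma prim_root_prodB (F : fieldType) m (z c v : F) : m.-primitive_root z ->
  \prod_(i < m) (c - z ^+ i * v) = c ^+ m - v ^+ m.
Proof.
move=> z_prim; have m_gt0 := prim_order_gt0 z_prim.
have [->|v0] := eqVneq v 0.
  under eq_bigr do rewrite mulr0 subr0.
  by rewrite prodr_const card_ord expr0n (gtn_eqF m_gt0) subr0.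
have := congr1 (fun p : {poly F} => p.[c / v] * v ^+ m) (factor_Xn_sub_1 z_prim).
rewrite /= !hornerE mulrBl mul1r expr_div_n divfK ?expf_neq0 // => <-.
rewrite big_mkord horner_prod -[X in v ^+ X]card_ord -prodr_const -big_split.
by apply: eq_bigr => i _; rewrite /= !hornerE mulrBl divfK.
Qed.

Section ClosedField.
Variable k : closedFieldType.

Lemma closed_root_Xn n (a : k) : (0 < n)%N -> exists x, x ^+ n = a.
Proof.
move=> n_gt0; have /closed_rootP[x] : size ('X^n - a%:P) != 1%N.
  by rewrite size_XnsubC // eqSS -lt0n.
by rewrite /root !hornerE subr_eq0 => /eqP; exists x.
Qed.

Lemma closed_root_quadratic (c : k) : exists y, y ^+ 2 + y = c.
Proof.
have /closed_rootP[y] : size ('X^2 + ('X - c%:P) : {poly k}) != 1%N.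
  by rewrite size_polyDl ?size_polyXn // size_XsubC.
by rewrite /root !hornerE subr_eq0 => /eqP; exists y.
Qed.

Lemma roots_of_unity n : n%:R != 0 :> k ->
  exists s : seq k, [/\ uniq s, size s = n & forall z, (z \in s) = (z ^+ n == 1)].
Proof.
move=> n0; have n_gt0 : (0 < n)%N by case: n n0; rewrite ?eqxx.
have [rs E] := closed_field_poly_normal ('X^n - 1 : {poly k}).
have lc : lead_coef ('X^n - 1 : {poly k}) = 1 by apply: lead_coefXnsubC.
rewrite lc scale1r in E.
exists rs; split.
- by rewrite -separable_prod_XsubC -E separable_Xn_sub_1.
- by apply: succn_inj; rewrite -(size_prod_XsubC rs id) -E size_XnsubC.
- by move=> z; rewrite -root_prod_XsubC -E /root !hornerE subr_eq0.
Qed.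

Lemma closed_prim_root n : n%:R != 0 :> k -> exists z : k, n.-primitive_root z.
Proof.
move=> n0; have n_gt0 : (0 < n)%N by case: n n0; rewrite ?eqxx.
have [rs [rs_uniq rs_size rsP]] := roots_of_unity n0.
have /hasP[z _ z_prim] : has n.-primitive_root rs.
  apply: has_prim_root; rewrite ?rs_size //.
  by apply/allP => z; rewrite unity_rootE rsP.
by exists z.
Qed.

(** A nonzero polynomial vanishing everywhere would stay without roots after the
    addition of 1. *)
Lemma poly_ext (p q : {poly k}) : (forall x, p.[x] = q.[x]) -> p = q.
Proof.
move=> pq; apply/eqP; rewrite -subr_eq0; apply/negPn/negP => r0.
have r_ev x : (p - q).[x] = 0 by rewrite !hornerE pq subrr.
have [s1|s1] := eqVneq (size (p - q)) 1%N.
  have /size_poly1P[c c0 E] : size (p - q) == 1%N by rewrite s1.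
  by move: c0; rewrite -[c](hornerC _ 0) -E r_ev eqxx.
have /closed_rootP[x] : size (p - q + 1) != 1%N.
  rewrite size_polyDl // size_poly1 ltn_neqAle eq_sym s1 /=.
  by rewrite size_poly_gt0.
by rewrite /root hornerD hornerC r_ev add0r oner_eq0.
Qed.

(** z and - 1 - z are the roots of T^2 + T - (z^2 + z), so that their power sums
    satisfy a linear recurrence with coefficients in k[z^2 + z]. *)
Lemma power_sum_poly j :
  exists S : {poly k}, forall z, S.[z ^+ 2 + z] = z ^+ j + (- 1 - z) ^+ j.
Proof.
suff: exists S T : {poly k}, forall z, S.[z ^+ 2 + z] = z ^+ j + (- 1 - z) ^+ j
    /\ T.[z ^+ 2 + z] = z ^+ j.+1 + (- 1 - z) ^+ j.+1.
  by move=> [S [T ST]]; exists S => z; have [] := ST z.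
elim: j => [|j [S [T ST]]].
  exists (1 + 1), (- 1) => z; rewrite !hornerE /= !expr1 !expr0; split=> //.
  by rewrite [RHS]addrAC subrr add0r.
exists T, ('X * S - T) => z; have [Sz Tz] := ST z; split=> //.
rewrite !hornerE Sz Tz !(exprSr _ j.+1) !(exprSr _ j).
by move: (z ^+ j) ((-1 - z) ^+ j) => P R; ring.
Qed.

(** * The function osculating the curve at a rational point *)

Section Existence.
Variables (l m Q : nat).
Hypothesis lm : (l * m = Q.+1)%N.
Hypothesis frobD : forall x y : k, (x + y) ^+ Q = x ^+ Q + y ^+ Q.
Hypothesis frob1 : (- 1 : k) ^+ Q = - 1.


Lemma frob_gt0 : (0 < Q)%N.
Proof. by case: Q frobD => // /(_ 0 0); rewrite !expr0 => /esym/eqP; rewrite -subr_eq0 addrK oner_eq0. Qed.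

(** The power sum of exponent Q + 1 minus 1. For odd p it is
    ((4 w + 1)^((Q + 1) / 2) - 1) / 2, and for p = 2 the sum of the w^(2^i) with
    2^i < Q. *)
Lemma trace_poly :
  exists E : {poly k}, forall z, E.[z ^+ 2 + z] = z ^+ Q + z + 2 * z ^+ Q * z.
Proof.
have [S SE] := power_sum_poly Q.+1.
exists (S - 1) => z; rewrite !hornerE SE !exprS frobD frob1 exprNn frob1; ring.
Qed.

(** With w = v0^Q v, the polynomial E satisfies E^2 + E = 4 w^Q w + w^Q + w; with
    L = b^Q + (2 b^Q + 1) y one has L^2 + L = (4 B + 1) (y^2 + y) + B, where
    B = b^(2 Q) + b^Q = v0^(Q (Q + 1)). The terms of degree Q + 1 in v cancel in
    the difference except for v^(Q + 1), which leaves a product of two factors. *)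
Lemma frobenius_line_norm (E : {poly k}) (v0 v b y : k) :
    (forall z, E.[z ^+ 2 + z] = z ^+ Q + z + 2 * z ^+ Q * z) ->
    y ^+ 2 + y = v ^+ Q.+1 -> b ^+ 2 + b = v0 ^+ Q.+1 ->
  (E.[v0 ^+ Q * v] - (b ^+ Q + (2 * b ^+ Q + 1) * y))
    * (E.[v0 ^+ Q * v] - (b ^+ Q + (2 * b ^+ Q + 1) * (- 1 - y)))
  = - ((v - v0) ^+ Q) * (v - v0 ^+ Q ^+ Q).
Proof.
move=> EP yv bv; have [z zE] := closed_root_quadratic (v0 ^+ Q * v).
rewrite -zE EP.
have vQ : (v - v0) ^+ Q = v ^+ Q - v0 ^+ Q by rewrite frobD exprNn frob1 mulN1r.
have zQ : (z ^+ Q) ^+ 2 + z ^+ Q = v0 ^+ Q ^+ Q * v ^+ Q.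
  by rewrite -exprMn -zE frobD -!exprM mulnC.
have bQ : (b ^+ Q) ^+ 2 + b ^+ Q = v0 ^+ Q ^+ Q * v0 ^+ Q.
  by rewrite -[RHS]exprMn -exprSr -bv frobD -!exprM mulnC.
have {}yv : y ^+ 2 + y = v ^+ Q * v by rewrite yv exprSr.
rewrite vQ; move: (z ^+ Q) (v0 ^+ Q ^+ Q) (v0 ^+ Q) (v ^+ Q) (b ^+ Q) zQ bQ yv zE.
move=> z' v0'' v0' v' b' zQ bQ yv zE.
have -> : (z' + z + 2 * z' * z - (b' + (2 * b' + 1) * y)) *
  (z' + z + 2 * z' * z - (b' + (2 * b' + 1) * (-1 - y)))
  = (4 * (z' ^+ 2 + z') + 1) * (z ^+ 2 + z) + (z' ^+ 2 + z')
    - (4 * (b' ^+ 2 + b') + 1) * (y ^+ 2 + y) - (b' ^+ 2 + b') by ring.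
by rewrite zQ zE bQ yv; ring.
Qed.

(** The product of E(v0^Q e v) - lam y over the m-th roots of unity e is a
    polynomial in v^m = x and lam y, which bivariate_reduction makes linear in y.
    Its norm is the product of those given by frobenius_line_norm, and the two
    factors coming from (a, b) and from its Frobenius image agree as a is
    fixed by the Q^2-power map. *)
Lemma osculating_function (a b : k) : m%:R != 0 :> k ->
    b ^+ 2 + b = a ^+ l -> a ^+ Q ^+ Q = a -> b ^+ Q ^+ Q = b -> b + b + 1 != 0 ->
  exists A B : {poly k}, exists c, [/\ c != 0,
    A ^+ 2 - A * B - B ^+ 2 * 'X^l = c *: ('X - a%:P) ^+ Q.+1 &
    A.[a] - B.[a] - B.[a] * b != 0].
Proof.
move=> m0 ab aQ bQ b0.
have m_gt0 : (0 < m)%N by case: (m) m0; rewrite ?eqxx.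
have [w w_prim] := closed_prim_root m0.
have [v0 v0E] := closed_root_Xn a m_gt0.
have [E EP] := trace_poly.
have bv : b ^+ 2 + b = v0 ^+ Q.+1 by rewrite ab -v0E -exprM mulnC lm.
(* v0 is the coordinate of a point over (a, b) on the cover y^2 + y = v^(Q + 1). *)
pose lam y := b ^+ Q + (2 * b ^+ Q + 1) * y.
pose g : {poly {poly k}} := map_poly polyC (E \Po (v0 ^+ Q *: 'X)) - 'X%:P.
have wP_prim : m.-primitive_root (w%:P : {poly k}) by rewrite fmorph_primitive_root.
have [N NE] := scale_norm_poly g wP_prim.
have N_ev v t : N.[v ^+ m, t] = \prod_(i < m) (E.[v0 ^+ Q * (w ^+ i * v)] - t).
  have := congr1 (fun p : {poly {poly k}} => p.[v%:P].[t]) NE.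
  rewrite /= horner_comp hornerXn -rmorphXn /= => ->.
  rewrite horner_prod horner_prod; apply: eq_bigr => i _.
  rewrite horner_comp /g hornerD hornerN hornerC hornerZ hornerX -rmorphXn -rmorphM /=.
  by rewrite horner_map /= !hornerE horner_comp !hornerE.
(* As lam is affine in y, it satisfies a quadratic equation over k[x] too:
   2 lam + 1 = (2 b^Q + 1) (2 y + 1). *)
pose B0 := (b ^+ Q) ^+ 2 + b ^+ Q.
have [A' [B' AB']] := bivariate_reduction 1 ((4 * B0 + 1) *: 'X^l + B0%:P) N.
pose A := A' + b ^+ Q *: B'; pose B := (2 * b ^+ Q + 1) *: B'.
have AB v y : y ^+ 2 + y = v ^+ Q.+1 ->
    A.[v ^+ m] + B.[v ^+ m] * y = \prod_(i < m) (E.[v0 ^+ Q * (w ^+ i * v)] - lam y).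
  move=> yv; have idP (p : {poly k}) : map_poly idfun p = p by apply: map_poly_id.
  have := AB' k idfun (v ^+ m) (lam y); rewrite !idP !hornerE -[(v ^+ m) ^+ l]exprM (mulnC m l) lm -yv.
  have -> : map_poly (map_poly idfun) N = N by apply: map_poly_id => p _ /=; rewrite idP.
  rewrite N_ev => ->; last by rewrite /lam /B0; move: (b ^+ Q) => bq /=; ring.
  by rewrite /lam /=; ring.
clearbody A B => {N N_ev NE g A' B' AB' B0}.
have wE v i : (w ^+ i * v) ^+ Q.+1 = v ^+ Q.+1.
  have wQ : w ^+ Q.+1 = 1 by rewrite -lm mulnC exprM (prim_expr_order w_prim) expr1n.
  by rewrite exprMn exprAC wQ expr1n mul1r.
have norm_i v y i : y ^+ 2 + y = v ^+ Q.+1 ->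
    (E.[v0 ^+ Q * (w ^+ i * v)] - lam y) * (E.[v0 ^+ Q * (w ^+ i * v)] - lam (- 1 - y))
    = - ((w ^+ i * v - v0) ^+ Q) * (w ^+ i * v - v0 ^+ Q ^+ Q).
  by move=> yv; apply: frobenius_line_norm => //; rewrite wE.
pose s : k := (-1) ^+ m.
have s0 : s != 0 by rewrite expf_neq0 // oppr_eq0 oner_neq0.
have prodE c v : \prod_(i < m) (w ^+ i * v - c) = s * (c ^+ m - v ^+ m).
  rewrite -(prim_root_prodB c v w_prim) /s -[X in _ ^+ X]card_ord -prodr_const -big_split.
  by apply: eq_bigr => i _; rewrite /= mulN1r opprB.
exists A, B, (s * (s * -1) ^+ Q * (s * -1)); split.
- by rewrite !(mulf_neq0, expf_neq0) // oppr_eq0 oner_neq0.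
- apply: poly_ext => x1.
  have [v vE] := closed_root_Xn x1 m_gt0.
  have [y yE] := closed_root_quadratic (x1 ^+ l).
  have yv : y ^+ 2 + y = v ^+ Q.+1 by rewrite yE -vE -exprM mulnC lm.
  have yv' : (-1 - y) ^+ 2 + (-1 - y) = v ^+ Q.+1 by rewrite -yv; ring.
  have -> : (A ^+ 2 - A * B - B ^+ 2 * 'X^l).[x1]
     = (A.[x1] + B.[x1] * y) * (A.[x1] + B.[x1] * (-1 - y)).
    by rewrite !hornerE -yE; ring.
  rewrite -vE !AB // -big_split /=.
  under eq_bigr => i _ do rewrite norm_i // -mulN1r.
  rewrite !big_split /= prodr_const card_ord -/s prodrXl !prodE v0E.
  have -> : v0 ^+ Q ^+ Q ^+ m = a.
    by rewrite -[RHS]aQ -v0E -!exprM; congr (_ ^+ _); rewrite [RHS]mulnC -mulnA.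
  rewrite hornerZ horner_exp hornerXsubC; move: (v ^+ m) => X.
  have -> : a - X = -1 * (X - a) by ring.
  rewrite [s * (-1 * _)]mulrA [(s * -1 * (X - a)) ^+ Q]exprMn [in RHS]exprS.
  by move: ((s * -1) ^+ Q) ((X - a) ^+ Q) => P R; ring.
have -> : A.[a] - B.[a] - B.[a] * b = A.[a] + B.[a] * (-1 - b) by ring.
rewrite -v0E AB; last by rewrite -bv; ring.
(* If a factor vanished at the conjugate point, the norm of this factor would
   force E = lam b as well, hence 2 lam b + 1 = 0. *)
apply/prodf_neq0 => i _; apply/eqP => E0.
have := norm_i v0 b i bv; rewrite E0 mulr0 => /esym/eqP.
rewrite mulf_eq0 oppr_eq0 expf_eq0 frob_gt0 /= => vi.
have EL : E.[v0 ^+ Q * (w ^+ i * v0)] = lam b.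
  case/orP: vi; rewrite subr_eq0 => /eqP vi.
    by rewrite vi -exprSr -bv EP /lam; ring.
  rewrite vi -exprS exprAC -bv.
  have -> : (b ^+ 2 + b) ^+ Q = (b ^+ Q) ^+ 2 + b ^+ Q by rewrite frobD -!exprM mulnC.
  by rewrite EP bQ /lam; ring.
move: E0; rewrite EL => E0.
have : (b + b + 1) ^+ Q * (b + b + 1) = 0.
  rewrite !frobD expr1n -E0 /lam; ring.
by move=> /eqP; rewrite -exprSr expf_eq0 (negPf b0) andbF.
Qed.


End Existence.
End ClosedField.

(** * Counting the rational points *)

Section Count.
Variable k : closedFieldType.

Variables (l m Q : nat).
Hypothesis lm : (l * m = Q.+1)%N.
Hypothesis l_odd : odd l.
Hypothesis l_gt2 : (2 < l)%N.
Hypothesis frobD : forall x y : k, (x + y) ^+ Q = x ^+ Q + y ^+ Q.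
Hypothesis frob1 : (- 1 : k) ^+ Q = - 1.
Hypothesis Q_eq0 : Q%:R = 0 :> k.

Lemma frobN (x : k) : (- x) ^+ Q = - x ^+ Q.
Proof. by rewrite exprNn frob1 mulN1r. Qed.

Lemma frobB (x y : k) : (x - y) ^+ Q = x ^+ Q - y ^+ Q.
Proof. by rewrite frobD frobN. Qed.

Lemma lm_neq0 : (l * m)%:R != 0 :> k.
Proof. by rewrite lm -natr1 Q_eq0 add0r oner_neq0. Qed.

Lemma Q_gt0 : (0 < Q)%N.
Proof. exact: frob_gt0 frobD. Qed.

(** The solution y of y^Q = z y and (y + 1)^Q = (t / z) (y + 1), two equations
    that are linear in y once y^Q is eliminated. *)
Definition ordinate (zt : k * k) : k := (zt.2 - zt.1) / (zt.1 ^+ 2 - zt.2).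

Lemma ordinate_frob z t : z ^+ Q.+1 = 1 -> t ^+ m = 1 -> z ^+ 2 != t ->
  ordinate (z, t) ^+ Q = z * ordinate (z, t).
Proof.
move=> zn tm zt.
have tn : t ^+ Q.+1 = 1 by rewrite -lm mulnC exprM tm expr1n.
have unitE (x : k) : x ^+ Q.+1 = 1 -> x != 0 /\ x ^+ Q = x^-1.
  move=> xn; have x0 : x != 0 by apply: contra_eq_neq xn => ->; rewrite expr0n eq_sym oner_neq0.
  by split=> //; apply: (mulfI x0); rewrite -exprS xn divff.
have [z0 zQ] := unitE z zn; have [t0 tQ] := unitE t tn.
rewrite /ordinate /= expr_div_n !frobB exprAC zQ tQ.
have d0 : z ^+ 2 - t != 0 by rewrite subr_eq0.
have d0' : z ^- 1 ^+ 2 - t^-1 != 0.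
  by rewrite expr1 exprVn subr_eq0 (inj_eq invr_inj).
have -> : z^-1 ^+ 2 - t^-1 = - (z ^+ 2 - t) / (z ^+ 2 * t).
  by field; rewrite ?z0 ?t0.
by field; rewrite ?z0 ?t0 ?d0 ?oppr_eq0 ?d0.
Qed.

(** When u^(Q - 1) = t is an m-th root of unity, u^((Q^2 - 1) / l) = t^m = 1, so
    that all l-th roots of u lie in the field with Q^2 elements. *)
Lemma abscissa_frob (u t x : k) : u != 0 -> u ^+ Q = t * u -> t ^+ m = 1 ->
  x ^+ l = u -> x ^+ Q ^+ Q = x.
Proof.
move=> u0 uQ tm xl; have x0 : x != 0.
  by apply: contraNneq u0 => x0; rewrite -xl x0 expr0n gtn_eqF // (ltn_trans _ l_gt2).
(* x^(Q^2) = e^(Q + 1) x, where e^l = t. *)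
pose e := x ^+ Q / x.
have xQ : x ^+ Q = e * x by rewrite divfK.
have el : e ^+ l = t by rewrite expr_div_n exprAC xl uQ mulfK.
rewrite xQ exprMn xQ mulrA -exprSr -lm exprM el tm mul1r //.
Qed.

(** The y with y^2 + y a nonzero l-th power in the field with Q^2 elements. *)
Definition good_ordinate (y : k) : Prop :=
  [/\ y != 0, y + 1 != 0, y ^+ Q ^+ Q = y &
      exists2 t, t ^+ m = 1 & (y ^+ 2 + y) ^+ Q = t * (y ^+ 2 + y)].

(** Here z = zt.1 and t / z are distinct n-th roots of unity other than 1. *)
Definition admissible (zt : k * k) : Prop :=
  [/\ zt.1 ^+ Q.+1 = 1, zt.2 ^+ m = 1, zt.1 != 1, zt.2 != zt.1 & zt.2 != zt.1 ^+ 2].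

Lemma ordinateE zt : zt.2 != zt.1 ^+ 2 ->
  [/\ ordinate zt + 1 = zt.1 * (zt.1 - 1) / (zt.1 ^+ 2 - zt.2) &
      zt.2 * (ordinate zt + 1) = zt.1 * (zt.1 * ordinate zt + 1)].
Proof.
case: zt => z t /= zt; have d0 : z ^+ 2 - t != 0 by rewrite subr_eq0 eq_sym.
by rewrite /ordinate /=; split; field.
Qed.

Lemma ordinate_neq0 zt : admissible zt -> ordinate zt != 0 /\ ordinate zt + 1 != 0.
Proof.
case: zt => z t [/= zn tm z1 tz tzz]; have [-> _] := ordinateE (zt := (z, t)) tzz.
have d0 : z ^+ 2 - t != 0 by rewrite subr_eq0 eq_sym.
have z0 : z != 0 by apply: contra_eq_neq zn => ->; rewrite expr0n eq_sym oner_neq0.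
by rewrite !mulf_neq0 // ?invr_eq0 // subr_eq0.
Qed.

Lemma ordinate_good zt : admissible zt -> good_ordinate (ordinate zt).
Proof.
case: zt => z t zt_ok; have [y0 y10] := ordinate_neq0 zt_ok.
case: zt_ok => /= zn tm z1 tz tzz.
have [_ yt] := ordinateE (zt := (z, t)) tzz; rewrite /= in yt.
have yQ := ordinate_frob zn tm; rewrite eq_sym in yQ; have {}yQ := yQ tzz.
set y := ordinate _ in y0 y10 yt yQ *.
split=> //; first by rewrite yQ exprMn yQ mulrA -exprSr zn mul1r.
exists t => //; rewrite frobD exprAC yQ.
have -> : (z * y) ^+ 2 + z * y = z * (z * y + 1) * y by ring.
by rewrite -yt; ring.
Qed.

Lemma ordinate_inj zt zt' : admissible zt -> admissible zt' ->
  ordinate zt = ordinate zt' -> zt = zt'.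
Proof.
move=> ok ok' E; have [y0 y10] := ordinate_neq0 ok.
case: zt zt' ok ok' E y0 y10 => [z t] [z' t'] ok ok' E y0 y10.
have [/= zn tm _ _ tzz] := ok; have [/= zn' tm' _ _ tzz'] := ok'.
have [_ yt] := ordinateE (zt := (z, t)) tzz.
have [_ yt'] := ordinateE (zt := (z', t')) tzz'.
have zz' : z = z'.
  apply: (mulIf y0); rewrite {2}E -!ordinate_frob // 1?eq_sym //.
  by rewrite E.
rewrite -zz' /= in yt yt' E *; congr (_, _).
by apply: (mulIf y10); rewrite yt E -yt'.
Qed.

(** There are m (n - m) admissible pairs with z outside the m-th roots of unity
    and (m - 1) (m - 2) with z among them, n being Q + 1. The nonzero elements of
    the field with Q elements, - 1 excepted, are good with t = 1. *)
Lemma good_ordinates : exists ys : seq k,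
  [/\ uniq ys, (m * (Q.+1 - m) + m.-1 * m.-2 + Q.-2 <= size ys)%N &
      forall y, y \in ys -> good_ordinate y].
Proof.
have n0 : Q.+1%:R != 0 :> k by rewrite -lm lm_neq0.
have m0 : m%:R != 0 :> k by have := lm_neq0; rewrite natrM mulf_eq0 negb_or => /andP[].
have m_gt0 : (0 < m)%N by case: (m) m0; rewrite ?eqxx.
have [Q1 q0] : (0 < Q)%N /\ Q.-1%:R != 0 :> k.
  split; first exact: Q_gt0.
  by rewrite -subn1 natrB ?Q_gt0 // Q_eq0 sub0r oppr_eq0 oner_neq0.
have [zs [zs_uniq zs_size zsP]] := roots_of_unity n0.
have [ts [ts_uniq ts_size tsP]] := roots_of_unity m0.
have [qs [qs_uniq qs_size qsP]] := roots_of_unity q0.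
have ts_zs : {subset ts <= zs}.
  by move=> t; rewrite tsP zsP -lm mulnC exprM => /eqP ->; rewrite expr1n.
(* In L1 the last two conditions of admissible hold since z and z^2 are not
   m-th roots of unity; in L2 they exclude exactly two values of t. *)
pose L1 := [seq (z, t) | z <- [seq z <- zs | z \notin ts], t <- ts].
pose L2 := [seq (z, t) | z <- rem 1 ts, t <- rem (z ^+ 2) (rem z ts)].
have one_ts : 1 \in ts by rewrite tsP expr1n.
have odd_cancel (e : k) : e ^+ 2 = 1 -> e ^+ l = 1 -> e = 1.
  by move=> e2; rewrite -(odd_double_half l) l_odd exprD -mul2n exprM e2 expr1n mulr1.
have ok1 zt : zt \in L1 -> admissible zt.
  case/allpairsP => -[z t] /= [z_in t_in ->]; move: z_in; rewrite mem_filter => /andP[zNts z_zs].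
  have t_m : t ^+ m = 1 by apply/eqP; rewrite -tsP.
  split=> //=; first by apply/eqP; rewrite -zsP.
  - by apply: contraNneq zNts => ->.
  - by apply: contraNneq zNts => <-.
  apply: contraNneq zNts => tz; rewrite tsP; apply/eqP/odd_cancel.
    by rewrite exprAC -tz.
  by rewrite -exprM mulnC lm; apply/eqP; rewrite -zsP.
have ok2 zt : zt \in L2 -> admissible zt.
  case/allpairsPdep => z [t [z_in t_in ->]].
  move: z_in t_in; rewrite mem_rem_uniq // inE mem_rem_uniq ?rem_uniq // inE mem_rem_uniq // inE.
  move=> /andP[z1 z_ts] /and3P[tzz tz t_ts].
  by split=> //=; apply/eqP; rewrite -?zsP -?tsP // ts_zs.
have uniq12 : uniq (L1 ++ L2).
  rewrite cat_uniq; apply/and3P; split.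
  - by apply: allpairs_uniq; rewrite ?filter_uniq // => -[? ?] [? ?] _ _.
  - apply/hasPn => zt /allpairsPdep[z [t [z_in t_in ->]]]; apply/negP => /allpairsP[[z' t'] /=].
    rewrite mem_filter => -[/andP[z'N _] _ [zE _]].
    by move: z'N; rewrite -zE (mem_rem z_in).
  - apply: allpairs_uniq_dep => [|z _|]; [exact: rem_uniq | by rewrite !rem_uniq |].
    by move=> [? ?] [? ?] _ _ /= [-> ->].
have size1 : (m * (Q.+1 - m) <= size L1)%N.
  rewrite size_allpairs ts_size mulnC leq_mul2r -zs_size size_filter leq_subLR.
  rewrite -{1}(count_predC (mem ts) zs) leq_add ?orbT //.
  rewrite -size_filter -ts_size uniq_leq_size ?filter_uniq // => z.
  by rewrite mem_filter => /andP[].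
have size2 : (m.-1 * m.-2 <= size L2)%N.
  rewrite size_allpairs_dep.
  have -> : [seq size (rem (z ^+ 2) (rem z ts)) | z <- rem 1 ts] = [seq m.-2 | z <- rem 1 ts].
    apply/eq_in_map => z; rewrite mem_rem_uniq // !inE => /andP[z1 z_ts].
    rewrite !size_rem ?ts_size // mem_rem_uniq // !inE tsP exprAC.
    move: (z_ts); rewrite tsP => /eqP ->; rewrite expr1n eqxx andbT.
    have z0 : z != 0 by apply: contraTneq z_ts => ->; rewrite tsP expr0n (gtn_eqF m_gt0) eq_sym oner_eq0.
    by rewrite expr2 -{3}[z]mulr1 (inj_eq (mulfI z0)).
  by rewrite sumnE big_map big_const_seq count_predT iter_addn_0 (size_rem one_ts) ts_size mulnC.
have ok12 zt : zt \in L1 ++ L2 -> admissible zt.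
  by rewrite mem_cat => /orP[/ok1|/ok2].
have m1_qs : -1 \in qs.
  rewrite qsP; apply/eqP/(mulfI (x := -1)); first by rewrite oppr_eq0 oner_neq0.
  by rewrite -exprS prednK ?Q_gt0 // frob1 mulr1.
have qs_frob y : y \in qs -> y != 0 /\ y ^+ Q = y.
  rewrite qsP => /eqP yq; split; last by rewrite -(prednK Q1) exprS yq mulr1.
  apply: contra_eq_neq yq => ->; rewrite expr0n eq_sym.
  by case: (Q.-1) q0 => [|i]; rewrite ?eqxx ?oner_neq0.
exists ([seq ordinate zt | zt <- L1 ++ L2] ++ rem (-1) qs); split.
- rewrite cat_uniq rem_uniq // andbT map_inj_in_uniq ?uniq12 /=; last first.
    by move=> zt zt' /ok12 ok /ok12 ok'; apply: ordinate_inj.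
  apply/hasPn => y /mem_rem /qs_frob[y0 yQ]; apply/negP => /mapP[[z t] /ok12 ok yE].
  have [/= zn tm z1 _ tzz] := ok.
  have := ordinate_frob zn tm; rewrite eq_sym -yE yQ => /(_ tzz) yz.
  by move: z1; rewrite -(inj_eq (mulIf y0)) -yz mul1r eqxx.
- by rewrite !size_cat size_map size_cat (size_rem m1_qs) qs_size !leq_add.
move=> y; rewrite mem_cat => /orP[/mapP[zt /ok12 ok ->]|]; first exact: ordinate_good.
rewrite mem_rem_uniq // inE => /andP[y_ne /qs_frob[y0 yQ]].
split=> //; first by rewrite addr_eq0.
  by rewrite !yQ.
by exists 1; rewrite ?expr1n // mul1r frobD exprAC yQ.
Qed.

(** The two sides differ by (l - 3) Q, so that equality holds for l = 3. *)
Lemma count_bound : (0 < m)%N ->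
  (Q.+1 ^ 2 <= l * (m * (Q.+1 - m) + m.-1 * m.-2 + Q.-2) + 3)%N.
Proof.
have [j lE] : exists j, l = j.+3 by exists (l - 3)%N; lia.
move: lm; rewrite lE; case: m => // -[|i] jm _.
  have -> : Q = j.+2 by lia.
  have -> : (j.+3 * (1 * (j.+3 - 1) + 1.-1 * 1.-2 + j.+2.-2) + 3
    = j.+3 ^ 2 + j * j.+2)%N by rewrite subn1 /=; ring.
  by rewrite leq_addr.
have QE : Q = (i.+2 * j.+2 + i.+1)%N by lia.
have -> : (Q.+1 - i.+2 = i.+2 * j.+2)%N by lia.
have -> : (Q.-2 = i.+1 * j.+2 + j + i.+1)%N by lia.
have -> : (j.+3 * (i.+2 * (i.+2 * j.+2) + i.+2.-1 * i.+2.-2 + (i.+1 * j.+2 + j + i.+1)) + 3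
  = Q.+1 ^ 2 + j * Q)%N by rewrite QE /=; ring.
by rewrite leq_addr.
Qed.

(** Each good ordinate carries l points; the ordinates 0 and - 1 carry one each.
    The successor of the size accounts for the point at infinity. *)
Lemma many_points : exists ps : seq (k * k),
  [/\ uniq ps, (Q.+1 ^ 2 <= (size ps).+1)%N &
      forall P, P \in ps -> [/\ P.2 ^+ 2 + P.2 = P.1 ^+ l,
        P.1 ^+ Q ^+ Q = P.1 & P.2 ^+ Q ^+ Q = P.2]].
Proof.
have [l0 m0] : l%:R != 0 :> k /\ m%:R != 0 :> k.
  by have := lm_neq0; rewrite natrM mulf_eq0 negb_or => /andP[].
have m_gt0 : (0 < m)%N by case: (m) m0; rewrite ?eqxx.
have l_gt0 : (0 < l)%N by apply: leq_trans l_gt2.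
have [ys [ys_uniq ys_size ys_good]] := good_ordinates.
have [ts [ts_uniq ts_size tsP]] := roots_of_unity l0.
have [f fP] := choice (fun u : k => closed_root_Xn u l_gt0).
pose ps := [seq (f (y ^+ 2 + y) * t, y) | y <- ys, t <- ts].
have f_neq0 y : y \in ys -> f (y ^+ 2 + y) != 0.
  move=> /ys_good[y0 y10 _ _]; have : y ^+ 2 + y != 0.
    by rewrite -[X in _ + X]mulr1 expr2 -mulrDr mulf_neq0.
  by apply: contraNneq => f0; rewrite -(fP (y ^+ 2 + y)) f0 expr0n gtn_eqF.
have ps_uniq : uniq ps.
  apply: allpairs_uniq => // -[y t] [y' t'] /allpairsP[[y1 t1] /= [y_in _ [yE _]]] _ /= [ft yy'].
  move: ft; rewrite -yy' yE => /(mulfI (f_neq0 _ y_in)) ->.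
  by [].
have ps_good P : P \in ps -> [/\ P.2 ^+ 2 + P.2 = P.1 ^+ l,
        P.1 ^+ Q ^+ Q = P.1 & P.2 ^+ Q ^+ Q = P.2].
  case/allpairsP => -[y t] /= [y_in t_in ->] /=.
  have [y0 y10 yQ [e em eQ]] := ys_good y y_in.
  have xl : (f (y ^+ 2 + y) * t) ^+ l = y ^+ 2 + y.
    by move: t_in; rewrite tsP exprMn fP => /eqP ->; rewrite mulr1.
  split=> //; apply: abscissa_frob eQ em xl.
  by rewrite -[X in _ + X]mulr1 expr2 -mulrDr mulf_neq0.
exists ([:: (0, 0); (0, -1)] ++ ps); split.
- rewrite cat_uniq ps_uniq andbT /= inE xpair_eqE eqxx /= andbT.
  rewrite eq_sym oppr_eq0 oner_neq0 /=; apply/hasPn => P.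
  case/allpairsP => -[y t] /= [y_in t_in ->]; rewrite !inE !xpair_eqE.
  by have [y0 y10 _ _] := ys_good y y_in; rewrite (negPf y0) -addr_eq0 (negPf y10) !andbF.
- apply: leq_trans (count_bound m_gt0) _.
  rewrite size_cat size_allpairs ts_size /= mulnC addnC !addSn !ltnS add0n.
  by rewrite leq_mul2r ys_size orbT.
have zl : (0 : k) ^+ l = 0 by rewrite expr0n gtn_eqF.
have zQ : (0 : k) ^+ Q = 0 by rewrite expr0n gtn_eqF // Q_gt0.
move=> P; rewrite mem_cat => /orP[|/ps_good //].
rewrite !inE => /orP[] /eqP -> /=; rewrite zl !zQ ?expr0n ?addr0 //.
by rewrite !frob1 -signr_odd /= subrr.
Qed.

End Count.

(** * The Jacobian *)

Section Transport.
Variables (k : closedFieldType) (l : nat) (l_odd : odd l).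
Hypothesis l_gt2 : (2 < l)%N.
Hypothesis l_neq0 : l%:R != 0 :> k.
Local Notation K := (function_field k l_odd).
Local Notation fc := (@fconst k l l_odd).
Local Notation X := (Defs.point k l).

Let l_gt1 : (1 < l)%N. Proof. exact: ltnW. Qed.
Let curve := fxyP k l_odd.
Let free := @curve_free k l l_odd.

Definition coords (P : X) : option (k * k) := omap val P.

Lemma coords_inj : injective coords.
Proof. by apply: inj_omap; apply: val_inj. Qed.

Lemma coords_on_curve P : on_curve l (coords P).
Proof. by case: P => [[[a b] /= /eqP]|]. Qed.

Lemma coords_surj Q : on_curve l Q -> exists P, coords P = Q.
Proof.
case: Q => [[a b] /= ab|_]; last by exists None.
have ab' : (a, b).2 ^+ 2 + (a, b).2 == (a, b).1 ^+ l by apply/eqP.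
by exists (Some (exist _ (a, b) ab')).
Qed.

Local Notation value_on P := (value_at fc (fx k l_odd) (fy k l_odd) l (coords P)).
Local Notation generates_on P :=
  (generates_at fc (fx k l_odd) (fy k l_odd) l (coords P)).

Lemma regular_atP P f : regular_at P f <-> exists c, value_on P f c.
Proof.
by case: P => [[[a b] ab]|] /=; split=> [[G [H [H0 ->]]]|[c [G [H [H0 -> _]]]]];
  try (by exists G, H); eexists; exists G, H.
Qed.

Lemma unit_atP P f : unit_at P f <-> exists2 c, c != 0 & value_on P f c.
Proof.
have on := coords_on_curve P.
split=> [[f0 /regular_atP[c vc] /regular_atP[d vd]]|[c c0 vc]].
  exists c => //; have := value_atM vc vd; rewrite divff // => v1.
  have := value_at_unique l_odd curve free on v1 (value_at1 _ _ _ _ _).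
  by move=> cd; apply: contra_eq_neq cd => ->; rewrite mul0r eq_sym oner_neq0.
split; first exact: (value_at_neq0 l_odd curve free on c0 vc).
  by apply/regular_atP; exists c.
by apply/regular_atP; exists c^-1; apply: value_atV.
Qed.

Lemma maximal_atP P f : maximal_at P f <-> value_on P f 0.
Proof.
have on := coords_on_curve P; split=> [[/regular_atP[c vc] fNu]|v0].
  have [<- //|c0] := eqVneq c 0.
  by case: fNu; apply/unit_atP; exists c.
split; first by apply/regular_atP; exists 0.
move=> /unit_atP[c c0 vc]; move: c0.
by rewrite (value_at_unique l_odd curve free on vc v0) eqxx.
Qed.

(** A uniformizer in the sense of the definition could only be 0 if the maximal
    ideal were 0, which generates_at_ex excludes. *)
Lemma uniformizerP P t : uniformizer P t <-> generates_on P t.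
Proof.
have [u gu] := generates_at_ex l_odd l_gt1 curve free l_neq0 (coords_on_curve P).
have max0 f : value_on P f 0 -> uniformizer P t -> exists g c, value_on P g c /\ f = g * t.
  move=> v0 [_ /(_ f)] []; first exact/maximal_atP.
  by move=> g /regular_atP[c vc] ->; exists g, c.
split=> [ut|gt].
  have t0 : t != 0.
    have [g [c [_ uE]]] := max0 u (generates_at_value gu) ut.
    by apply: contraNneq (generates_at_neq0 gu) => t0; rewrite uE t0 mulr0.
  have vt : value_on P t 0 by apply/maximal_atP; case: ut.
  case: P {u gu} ut max0 vt => [[[a b] ab]|] ut max0 vt; split=> // f vf; exact: max0.
split; first by apply/maximal_atP; apply: generates_at_value.
move=> f /maximal_atP /(generates_at_div gt)[g [c [vg ->]]].
by exists g => //; apply/regular_atP; exists c.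
Qed.

Lemma has_orderP P f n :
  has_order P f n <-> order_at fc (fx k l_odd) (fy k l_odd) l (coords P) f n.
Proof.
by split=> ordf t /uniformizerP ut; apply/unit_atP; apply: ordf.
Qed.

Lemma principalP (D : divisor0 k l) : D \in principal l_odd <->
  exists2 f : K, f != 0 & forall P, has_order P f (coeff P D).
Proof. by split => [/asboolP|?] //; apply/asboolP. Qed.

Lemma embed_inj : injective (@embed k l l_odd).
Proof.
move=> P Q /eqP; rewrite /embed -Quotient.idealrBE => /principalP[f _ ordf].
apply/eqP/negPn/negP => PQ.
have cPQ : coords P != coords Q by rewrite (inj_eq coords_inj).
apply: (no_simple_pole l_odd l_gt1 curve free l_neq0 _ _ l_gt2
  (coords_on_curve P) (coords_on_curve Q) cPQ (f := f)).
- by move=> p /closed_rootP.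
- exact: function_fieldP.
move=> _ /coords_surj[R <-]; have /has_orderP := ordf R.
rewrite /= !coeffB !coeffU !(inj_eq coords_inj) ![_ == R]eq_sym !mul1r !natz.
by rewrite opprB addrA subrK.
Qed.

Lemma order_at_fun_neq0 f n :
  order_at fc (fx k l_odd) (fy k l_odd) l None f n -> f != 0.
Proof.
have gw := generates_at_inf l_odd curve free.
move=> /(_ _ gw)[c c0 vc]; apply: contraNneq c0 => f0.
rewrite f0 mul0r in vc.
by rewrite (value_at_unique l_odd curve free (P := None) I vc (value_at0 _ _ _ _ _)).
Qed.

Lemma embed_torsion P n (f : K) : f != 0 ->
    (forall R, has_order R f (((R == P)%:Z - (R == None)%:Z) *+ n)) ->
  @embed k l l_odd P *+ n = 0.
Proof.
move=> f0 ordf; rewrite /embed.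
pose D := Divisor0 (embed_degree0 P).
have -> : \pi_(Quotient.quot (principal l_odd)) D *+ n
    = \pi_(Quotient.quot (principal l_odd)) (D *+ n).
  by rewrite -raddfMn.
have <- : \pi_(Quotient.quot (principal l_odd)) (0 : divisor0 k l) = 0.
  exact: raddf0.
apply/eqP; rewrite -Quotient.idealrBE subr0; apply/principalP; exists f => // R.
have -> : coeff R (div0_val (D *+ n)) = ((R == P)%:Z - (R == None)%:Z) *+ n; last exact: ordf.
have -> : div0_val (D *+ n) = (<<P>> - <<None>>) *+ n.
  exact: (raddfMn (val : divisor0 k l -> {freeg X})).
rewrite raddfMn /= raddfB /= !coeffU !mul1r !natz.
by rewrite ![_ == R]eq_sym.
Qed.

Lemma embed_torsion_single P n f : P != None ->
    (forall R, on_curve l R ->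
      order_at fc (fx k l_odd) (fy k l_odd) l R f (single_zero (coords P) n R)) ->
  @embed k l l_odd P *+ n = 0.
Proof.
move=> P_aff ordf; have f0 := order_at_fun_neq0 (ordf None I).
apply: (embed_torsion f0) => R; apply/has_orderP.
have -> : ((R == P)%:Z - (R == None)%:Z) *+ n = single_zero (coords P) n (coords R).
  rewrite /single_zero (inj_eq coords_inj).
  have [->|RP] := eqVneq R P; first by rewrite (negPf P_aff) subr0; apply: natz.
  case: R RP => [R|] _; first by rewrite /= subrr mul0rn.
  by rewrite /= sub0r mulNrn; congr (- _); apply: natz.
exact/ordf/coords_on_curve.
Qed.

Variables (m Q : nat).
Hypothesis lm : (l * m = Q.+1)%N.
Hypothesis frobD : forall x y : k, (x + y) ^+ Q = x ^+ Q + y ^+ Q.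
Hypothesis frob1 : (- 1 : k) ^+ Q = - 1.
Hypothesis Q_eq0 : Q%:R = 0 :> k.

Lemma rational_point_torsion P (a b : k) : coords P = Some (a, b) ->
  a ^+ Q ^+ Q = a -> b ^+ Q ^+ Q = b -> @embed k l l_odd P *+ Q.+1 = 0.
Proof.
move=> PE aQ bQ; have P_aff : P != None by apply: contra_eq_neq PE => ->.
have ab : b ^+ 2 + b = a ^+ l by have := coords_on_curve P; rewrite PE.
have m0 : m%:R != 0 :> k.
  by have := lm_neq0 lm Q_eq0; rewrite natrM mulf_eq0 negb_or => /andP[].
have [b0|b0] := eqVneq (b + b + 1) 0; last first.
  have [A [B [c [c0 norm conj0]]]] := osculating_function lm frobD frob1 m0 ab aQ bQ b0.
  pose f := (map_poly fc A).[fx k l_odd] + (map_poly fc B).[fx k l_odd] * fy k l_odd.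
  apply: (embed_torsion_single (f := f)) => // R R_on.
  rewrite PE.
  exact: (order_at_single l_odd l_gt1 curve free (ab : on_curve l (Some (a, b)))
    (ltn0Sn Q) c0 norm conj0 R_on).
have Q_odd : odd Q.
  apply: contraPT b0 => Q_even; have := frob1; rewrite -signr_odd (negPf Q_even) expr0.
  move=> /eqP; rewrite -addr_eq0 => /eqP two0.
  have -> : b + b = b * (1 + 1) by rewrite mulrDr mulr1.
  by rewrite two0 mulr0 add0r; apply/eqP/oner_neq0.
have QE : (Q.+1)%N = (Q.+1./2).*2 by have := odd_double_half Q.+1; rewrite /= Q_odd.
rewrite QE.
apply: (embed_torsion_single (f := (fx k l_odd - fc a) ^+ Q.+1./2)) => // R R_on.
rewrite PE; apply: (order_at_branch l_odd l_gt1 curve free l_neq0 _ _ b0 R_on) => //.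
by case: (Q) Q_odd.
Qed.

Lemma many_torsion_points :
  (`I_(Q.+1 ^ 2) #<= range (@embed k l l_odd) `&` torsion Q.+1)%card.
Proof.
have [ps [ps_uniq ps_size ps_good]] := many_points lm l_odd l_gt2 frobD frob1 Q_eq0.
have lift P : P \in ps -> exists R, coords R = Some P.
  by case: P => a b /ps_good[/= ab _ _]; apply: coords_surj.
pose s := None :: map Some ps.
have s_uniq : uniq s.
  rewrite /= map_inj_uniq ?ps_uniq ?andbT; last by move=> ? ? [].
  by apply/mapP => -[].
have pts i : exists R : X, coords R = nth None s i.
  have [|i_s] := ltnP i (size s); last by exists None; rewrite nth_default.
  move=> /(mem_nth None); rewrite inE => /orP[/eqP ->|]; first by exists None.
  by move=> /mapP[P /lift[R <-] ->]; exists R.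
have [pt ptE] := choice pts.
pose e i := @embed k l l_odd (pt i).
have e_inj : {in `I_(Q.+1 ^ 2) &, injective e}.
  move=> i j; rewrite !inE /= => iN jN /embed_inj pij.
  have size_s : size s = (size ps).+1 by rewrite /= size_map.
  apply/eqP; rewrite -(nth_uniq None _ _ s_uniq) ?size_s ?(leq_trans _ ps_size) //.
  by rewrite -!ptE pij.
apply/card_subP; exists (e @` `I_(Q.+1 ^ 2)); first exact: inj_card_eq.
move=> _ [i iN <-]; split; first by exists (pt i).
rewrite /torsion /= /e; case EP : (coords (pt i)) => [[a b]|].
  have : nth None s i \in s.
    by apply: mem_nth; rewrite /= size_map (leq_trans _ ps_size).
  rewrite -ptE EP inE /= => /mapP[P /ps_good[_ aQ bQ] [PE]].
  by apply: (rational_point_torsion EP); rewrite -PE in aQ bQ.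
have -> : pt i = None by apply: coords_inj.
by apply: (embed_torsion (f := 1)) => [|R]; rewrite ?oner_neq0 // subrr mul0rn; apply: has_order1.
Qed.

End Transport.

(** - 1 is a unit modulo l, hence a power of the generator u. *)
Lemma power_minus_one (p l : nat) (u : {unit 'Z_l}) : prime l -> odd l ->
    FinRing.uval u = p%:R -> generator (units_Zp l) u ->
  exists2 j, (0 < j)%N & forall i, (l %| (p ^ (j * i.*2.+1)).+1)%N.
Proof.
move=> l_prime l_odd u_p u_gen; have l_gt1 := prime_gt1 l_prime.
have natr0 i : (i%:R == 0 :> 'Z_l) = (l %| i)%N.
  rewrite Zp_nat -(inj_eq val_inj) /= Zp_cast //.
have N1_unit : (-1 : 'Z_l) \is a GRing.unit by rewrite unitrN unitr1.
have : FinRing.unit _ N1_unit \in <[u]>%g by rewrite -(eqP u_gen) inE.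
move=> /cycleP[j uj]; have jE : -1 = p%:R ^+ j :> 'Z_l.
  by rewrite -u_p -[LHS]/(FinRing.uval (FinRing.unit _ N1_unit)) uj FinRing.val_unitX.
have l_ne2 : (-1 : 'Z_l) != 1.
  rewrite -subr_eq0 -opprD oppr_eq0 -[1 + 1]/(2%:R) natr0.
  by apply: contraTN l_odd => /(dvdn_leq (ltn0Sn 1)); case: (l) l_gt1 => [|[|[|]]].
exists j; first by case: j {uj} jE l_ne2 => // ->; rewrite expr0 eqxx.
by move=> i; rewrite -natr0 -natr1 natrX exprM -jE -signr_odd /= odd_double expr1 addNr.
Qed.

Theorem proposition5p7 (k : closedFieldType) (p l : nat)
    (p_char : p \in [pchar k]) (l_prime : prime l) (l_odd : odd l)
    (u : {unit 'Z_l}) (u_p : FinRing.uval u = p%:R)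
    (u_gen : generator (units_Zp l) u) :
  infinite_set [set N : nat | (0 < N)%N /\
    (`I_(N ^ 2) #<= range (@embed k l l_odd) `&` torsion N)%card].
Proof.
have [j j_gt0 dvd_j] := power_minus_one l_prime l_odd u_p u_gen.
have p_prime := pcharf_prime p_char.
have l_gt2 : (2 < l)%N by have := prime_gt1 l_prime; case: (l) l_odd => [|[|[|]]].
move=> /finite_seqP[s sE].
pose b := \sum_(i <- s) i; pose Q := (p ^ (j * b.*2.+1))%N.
have Q_in : Q.+1 \in s; last first.
  have : (Q.+1 <= b)%N by rewrite /b (big_rem _ Q_in) leq_addr.
  apply/negP; rewrite -ltnNge ltnS.
  apply: leq_trans (ltnW (ltn_expl _ (prime_gt1 p_prime))) .
  by case: (j) j_gt0 => // i _; rewrite mulSn -addnn; lia.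
suff : [set N : nat | (0 < N)%N /\
    (`I_(N ^ 2) #<= range (@embed k l l_odd) `&` torsion N)%card] Q.+1 by rewrite sE.
split=> //; have /dvdnP[m lm] := dvd_j b.
have Q_eq0 : Q%:R = 0 :> k.
  apply/eqP; rewrite -(dvdn_pcharf p_char) /Q.
  by rewrite -(prednK (_ : 0 < j * b.*2.+1)%N) ?muln_gt0 ?j_gt0 // expnS dvdn_mulr.
have l_neq0 : l%:R != 0 :> k.
  have : (m * l)%:R != 0 :> k by rewrite -lm -natr1 Q_eq0 add0r oner_neq0.
  by rewrite natrM mulf_eq0 negb_or => /andP[].
have frobD (x y : k) : (x + y) ^+ Q = x ^+ Q + y ^+ Q.
  apply: exprDn_pchar; rewrite (eq_pnat _ (pcharf_eq p_char)).
  by rewrite pnatX pnat_id.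
have frob1 : (-1 : k) ^+ Q = -1.
  have := frobD 1 (-1); rewrite subrr expr1n expr0n.
  rewrite gtn_eqF ?expn_gt0 ?prime_gt0 // => /eqP.
  by rewrite eq_sym addrC addr_eq0 => /eqP.
by apply: (many_torsion_points l_odd l_gt2 l_neq0 _ frobD frob1 Q_eq0 (m := m)); rewrite mulnC.
Qed.
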